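(* Let $X,Y\in 2^\omega$. Then $X\oplus Y$ is higher Martin-Löf random if and only if $X$ is higher Martin-Löf random and $Y$ is higher $X$-Martin-Löf random.
   Context: A set of natural numbers or strings is higher c.e. if it is $\Pi^1_1$. An enumeration functional is a set $\Psi$ of pairs $(\tau,m)$ with $\tau$ a finite binary string and $m\in\omega$; for $X\in 2^{\le\omega}$, $\Psi^X=\{m : (\tau,m)\in\Psi\text{ for some }\tau\preceq X\}$. A set $B\subseteq\omega$ is higher $X$-c.e. if $B=\Psi^X$ for some $\Pi^1_1$ enumeration functional $\Psi$. A higher $X$-Martin-Löf test is a sequence $(U_n)$ such that for some $\Pi^1_1$ enumeration functional $\Psi$ (with numbers coding pairs $(n,\sigma)$, $\sigma$ a string), $U_n=\bigcup\{[\sigma] : (n,\sigma)\in\Psi^X\}$ and $\lambda(U_n)\le 2^{-n}$ for all $n$; $Z$ is higher $X$-Martin-Löf random if $Z\notin\bigcap_n U_n$ for every such test. Higher Martin-Löf random means higher $\emptyset$-Martin-Löf random. $X\oplus Y$ denotes the join $\{2n:n\in X\}\cup\{2n+1:n\in Y\}$. *)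

(* Defs.v *)
From Stdlib Require Cantor.
From mathcomp Require Import all_boot all_order all_algebra.
From mathcomp Require Import boolp classical_sets reals ereal topology esum cantor.

Set Implicit Arguments.
Unset Strict Implicit.
Unset Printing Implicit Defensive.

Import Order.TTheory GRing.Theory Num.Theory.

Local Open Scope classical_set_scope.

(* Formulas of arithmetic with number quantifiers (de Bruijn indices) and a
   single free function variable f; [App t] is the term f(t). *)
Inductive term : Type :=
| Var of nat
| Zero
| Succ of term
| Plus of term & term
| Times of term & term
| App of term.

Inductive formula : Type :=
| Eq of term & term
| Not of formula
| And of formula & formula
| Or of formula & formula
| Imp of formula & formula
| All of formula
| Ex of formula.

Fixpoint term_eval (f : nat -> nat) (e : seq nat) (t : term) : nat :=
  match t with
  | Var i => nth 0 e i
  | Zero => 0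
  | Succ t => (term_eval f e t).+1
  | Plus t u => term_eval f e t + term_eval f e u
  | Times t u => term_eval f e t * term_eval f e u
  | App t => f (term_eval f e t)
  end.

Fixpoint holds (f : nat -> nat) (e : seq nat) (p : formula) : Prop :=
  match p with
  | Eq t u => term_eval f e t = term_eval f e u
  | Not p => ~ holds f e p
  | And p q => holds f e p /\ holds f e q
  | Or p q => holds f e p \/ holds f e q
  | Imp p q => holds f e p -> holds f e q
  | All p => forall n, holds f (n :: e) p
  | Ex p => exists n, holds f (n :: e) p
  end.

(* Lightface: n is the only parameter, since variables of index greater than 0
   that are not bound by a quantifier evaluate to 0. *)
Definition Pi11 (A : set nat) : Prop :=
  exists p : formula, forall n, A n <-> forall f : nat -> nat, holds f [:: n] p.

(* The bijection between binary strings and natural numbers that enumerates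
   strings by length: s has code m iff m + 1 is written, in binary with the
   least significant digit first, as s followed by 1. *)
Fixpoint str_code (s : seq bool) : nat :=
  if s is b :: s' then (str_code s').*2 + b.+1 else 0.

Definition pair_code (m n : nat) : nat := Cantor.to_nat (m, n).

(* X extends the string s *)
Definition extends (X : cantor_space) (s : seq bool) : Prop :=
  s = mkseq X (size s).

Definition cylinder (s : seq bool) : set cantor_space := [set X | extends X s].

Definition enum_functional (Psi : set (seq bool * nat)) : Prop :=
  Pi11 [set k | exists tm, Psi tm /\ k = pair_code (str_code tm.1) tm.2].

Definition enumerated (Psi : set (seq bool * nat)) (X : cantor_space) : set nat :=
  [set m | exists2 t, extends X t & Psi (t, m)].

Definition higher_ce (X : cantor_space) (B : set nat) : Prop :=
  exists2 Psi, enum_functional Psi & B = enumerated Psi X.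

(* The uniform measure on Cantor space, as the outer measure generated by
   assigning measure 2^-|s| to the cylinder of s. *)
Definition lambda (R : realType) (A : set cantor_space) : \bar R :=
  ereal_inf [set (\esum_(s in W) (2 ^- size s)%:E)%R |
              W in [set W : set (seq bool) | A `<=` \bigcup_(s in W) cylinder s]].

Definition higher_ML_test (R : realType) (X : cantor_space)
    (U : nat -> set cantor_space) : Prop :=
  exists2 B : set nat, higher_ce X B &
    forall n, U n = \bigcup_(s in [set s | B (pair_code n (str_code s))]) cylinder s
           /\ (lambda R (U n) <= (2 ^- n)%:E%R)%E.

Definition higher_ML_random_rel (R : realType) (X Z : cantor_space) : Prop :=
  forall U, higher_ML_test R X U -> ~ (\bigcap_n U n) Z.

Definition empty_oracle : cantor_space := fun=> false.

Definition higher_ML_random (R : realType) (Z : cantor_space) : Prop :=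
  higher_ML_random_rel R empty_oracle Z.

Definition oracle_join (X Y : cantor_space) : cantor_space :=
  fun k => if odd k then Y k./2 else X k./2.

(* Main.v *)
(* The measure of an open set is at most [2^-n] if and only if, at every level [K], at most
   [2^(K-n)] strings of length [K] extend one of its generators, so tests are handled by counting.

   If [Y] is captured by an [X]-test, the test is trimmed into one for the join. A Pi11 set carries
   a norm: its complement is the set of parameters for which some arithmetical tree has an infinite
   branch, and ranks of trees are compared by simulations. For each rectangle [tau] x [sig] of the
   test, in the order of this norm, keep [sig] only over the oracles whose section enumerated so far
   has measure at most [2^-n]. This is a closed set of oracles, Delta11 uniformly in the rectangle,
   and it is replaced by a clopen superset, with an error that sums to [2^-n] over all rectangles.
   The result has measure at most [2 * 2^-n] and still contains the section at [X].

   Conversely, by Markov's inequality the oracles at which a test of measure [2^-2n] has a section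
   of measure above [2^-n] form an open set of measure at most [2^-n]. If [X] is random, it avoids all
   but finitely many of them, and the sections at [X] are an [X]-test. *)

From Stdlib Require Cantor.
Require Import Defs.
From mathcomp Require Import boolp classical_sets cardinality fsbigop reals ereal topology esum cantor.
From mathcomp Require Import all_boot all_order all_algebra zify.

Set Implicit Arguments.
Unset Strict Implicit.
Unset Printing Implicit Defensive.

(** Classically an oracle test is trimmed at finite stages, where bounding the measure of a section
    is a clopen condition on the oracle. Here a stage is an ordinal and may already contain
    infinitely many rectangles, so the condition is only closed, while an enumeration functional has
    to commit after finitely many bits of the oracle. The error allowed to a rectangle is tied to
    its index, a natural number, and not to its stage; this is why the errors can be summed.

    On the logical side, the measure condition and the choice of a level use the comparison of
    stages both positively and negatively. This comparison is Delta11 only relative to an index that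
    does get enumerated, so complements are always taken within that Pi11 domain. *)

(** * Semantics and substitution for formulas of arithmetic *)

Definition scons (n : nat) (e : nat -> nat) : nat -> nat :=
  fun i => if i is j.+1 then e j else n.

Notation shift e := (fun i : nat => e i.+1).

Lemma scons_shift (e : nat -> nat) : scons (e 0) (shift e) = e.
Proof. by apply: funext; case. Qed.

Fixpoint teval (f e : nat -> nat) (t : term) : nat :=
  match t with
  | Var i => e i
  | Zero => 0
  | Succ t => (teval f e t).+1
  | Plus t u => teval f e t + teval f e u
  | Times t u => teval f e t * teval f e u
  | App t => f (teval f e t)
  end.

(* The semantics of [Defs], with environments as functions: de Bruijn shifts then compute. *)
Fixpoint sat (f e : nat -> nat) (p : formula) : Prop :=
  match p with
  | Eq t u => teval f e t = teval f e u
  | Not p => ~ sat f e p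
  | And p q => sat f e p /\ sat f e q
  | Or p q => sat f e p \/ sat f e q
  | Imp p q => sat f e p -> sat f e q
  | All p => forall n, sat f (scons n e) p
  | Ex p => exists n, sat f (scons n e) p
  end.

Lemma term_eval_teval f e t : term_eval f e t = teval f (nth 0 e) t.
Proof. by elim: t => //= [t ->|t -> u ->|t -> u ->|t ->]. Qed.

Lemma holds_sat f e p : holds f e p <-> sat f (nth 0 e) p.
Proof.
have nthS n l : nth 0 (n :: l) = scons n (nth 0 l) by apply: funext; case.
elim: p e => /= [t u|p IH|p IHp q IHq|p IHp q IHq|p IHp q IHq|p IH|p IH] e.
- by rewrite !term_eval_teval.
- by rewrite IH.
- by rewrite IHp IHq.
- by rewrite IHp IHq.
- by rewrite IHp IHq.
- by split=> H n; move: (H n); rewrite IH nthS.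
- by split=> -[n H]; exists n; move: H; rewrite IH nthS.
Qed.

Fixpoint tsub (s : nat -> term) (t : term) : term :=
  match t with
  | Var i => s i
  | Zero => Zero
  | Succ t => Succ (tsub s t)
  | Plus t u => Plus (tsub s t) (tsub s u)
  | Times t u => Times (tsub s t) (tsub s u)
  | App t => App (tsub s t)
  end.

Definition up (s : nat -> term) (i : nat) : term :=
  if i is j.+1 then tsub (fun k => Var k.+1) (s j) else Var 0.

Fixpoint fsub (s : nat -> term) (p : formula) : formula :=
  match p with
  | Eq t u => Eq (tsub s t) (tsub s u)
  | Not p => Not (fsub s p)
  | And p q => And (fsub s p) (fsub s q)
  | Or p q => Or (fsub s p) (fsub s q)
  | Imp p q => Imp (fsub s p) (fsub s q)
  | All p => All (fsub (up s) p)
  | Ex p => Ex (fsub (up s) p)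
  end.

Lemma teval_sub f e s t : teval f e (tsub s t) = teval f (fun i => teval f e (s i)) t.
Proof. by elim: t => //= [t ->|t -> u ->|t -> u ->|t ->]. Qed.

Lemma sat_sub f e s p : sat f e (fsub s p) <-> sat f (fun i => teval f e (s i)) p.
Proof.
have upE n (e' : nat -> nat) s' :
    (fun i => teval f (scons n e') (up s' i)) = scons n (fun i => teval f e' (s' i)).
  by apply: funext; case=> //= i; rewrite teval_sub.
elim: p e s => /= [t u|p IH|p IHp q IHq|p IHp q IHq|p IHp q IHq|p IH|p IH] e s.
- by rewrite !teval_sub.
- by rewrite IH.
- by rewrite IHp IHq.
- by rewrite IHp IHq.
- by rewrite IHp IHq.
- by split=> H n; move: (H n); rewrite IH upE.
- by split=> -[n H]; exists n; move: H; rewrite IH upE.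
Qed.

(** * Arithmetical relations *)

Definition arith (P : (nat -> nat) -> (nat -> nat) -> Prop) : Prop :=
  exists p, forall f e, P f e <-> sat f e p.

(** A function is handled through its graph, with the value in slot 0. This covers pairing,
    projections, powers of 2 and bits of codes, for which there are no terms. *)
Definition arith_fn (t : (nat -> nat) -> (nat -> nat) -> nat) : Prop :=
  arith (fun f e => e 0 = t f (shift e)).

Lemma ar_iff (P Q : (nat -> nat) -> (nat -> nat) -> Prop) :
  (forall f e, P f e <-> Q f e) -> arith Q -> arith P.
Proof. by move=> PQ [p H]; exists p => f e; rewrite PQ. Qed.

Lemma ar_ren (r : nat -> nat) P : arith P -> arith (fun f e => P f (fun i => e (r i))).
Proof.
move=> [p H]; exists (fsub (fun i => Var (r i)) p) => f e.
by rewrite sat_sub H.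
Qed.

Lemma ar_and P Q : arith P -> arith Q -> arith (fun f e => P f e /\ Q f e).
Proof. by move=> [p Hp] [q Hq]; exists (And p q) => f e /=; rewrite Hp Hq. Qed.

Lemma ar_or P Q : arith P -> arith Q -> arith (fun f e => P f e \/ Q f e).
Proof. by move=> [p Hp] [q Hq]; exists (Or p q) => f e /=; rewrite Hp Hq. Qed.

Lemma ar_imp P Q : arith P -> arith Q -> arith (fun f e => P f e -> Q f e).
Proof. by move=> [p Hp] [q Hq]; exists (Imp p q) => f e /=; rewrite Hp Hq. Qed.

Lemma ar_not P : arith P -> arith (fun f e => ~ P f e).
Proof. by move=> [p Hp]; exists (Not p) => f e /=; rewrite Hp. Qed.

Lemma ar_all (P : (nat -> nat) -> (nat -> nat) -> nat -> Prop) :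
  arith (fun f e => P f (shift e) (e 0)) -> arith (fun f e => forall n, P f e n).
Proof.
move=> [p Hp]; exists (All p) => f e /=.
by split=> H n; move: (H n); move/(_ f (scons n e)): Hp => /= ->.
Qed.

Lemma ar_ex (P : (nat -> nat) -> (nat -> nat) -> nat -> Prop) :
  arith (fun f e => P f (shift e) (e 0)) -> arith (fun f e => exists n, P f e n).
Proof.
move=> [p Hp]; exists (Ex p) => f e /=.
by split=> -[n H]; exists n; move: H; move/(_ f (scons n e)): Hp => /= ->.
Qed.

Lemma fn_term u : arith_fn (fun f e => teval f e u).
Proof.
exists (Eq (Var 0) (tsub (fun i => Var i.+1) u)) => f e /=.
by rewrite teval_sub.
Qed.

Lemma fn_shift t : arith_fn t -> arith_fn (fun f e => t f (shift e)).
Proof. exact: (ar_ren (fun i => if i is j.+1 then j.+2 else 0)). Qed.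

Lemma ar_let (Q : (nat -> nat) -> (nat -> nat) -> nat -> Prop) t :
  arith_fn t -> arith (fun f e => Q f (shift e) (e 0)) -> arith (fun f e => Q f e (t f e)).
Proof.
move=> Ht HQ; apply: (@ar_iff _ (fun f e => exists n, n = t f e /\ Q f e n)).
  by move=> f e; split=> [H|[n [-> //]]]; exists (t f e).
by apply: ar_ex; apply: ar_and.
Qed.

Lemma ar2 (P : nat -> nat -> Prop) t u :
  arith (fun _ e => P (e 0) (e 1)) -> arith_fn t -> arith_fn u -> arith (fun f e => P (t f e) (u f e)).
Proof.
move=> HP Ht Hu; apply: (@ar_let (fun f e n => P n (u f e)) _ Ht).
apply: (@ar_let (fun f e n => P (e 0) n) _ (fn_shift Hu)).
exact: (ar_ren (fun i => if i is 0 then 1 else 0) HP).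
Qed.

Lemma ar3 (P : nat -> nat -> nat -> Prop) t u v :
  arith (fun _ e => P (e 0) (e 1) (e 2)) -> arith_fn t -> arith_fn u -> arith_fn v ->
  arith (fun f e => P (t f e) (u f e) (v f e)).
Proof.
move=> HP Ht Hu Hv; apply: (@ar_let (fun f e n => P n (u f e) (v f e)) _ Ht).
apply: (@ar_let (fun f e n => P (e 0) n (v f (shift e))) _ (fn_shift Hu)).
apply: (@ar_let (fun f e n => P (e 1) (e 0) n) _ (fn_shift (fn_shift Hv))).
exact: (ar_ren (fun i => match i with 0 => 2 | 1 => 1 | _ => 0 end) HP).
Qed.

Lemma ar_eq t u : arith_fn t -> arith_fn u -> arith (fun f e => t f e = u f e).
Proof. by apply: (@ar2 eq); exists (Eq (Var 0) (Var 1)). Qed.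

Lemma fn1 (g : nat -> nat) t : arith_fn (fun _ e => g (e 0)) -> arith_fn t ->
  arith_fn (fun f e => g (t f e)).
Proof.
move=> Hg Ht; apply: (@ar_let (fun f e n => e 0 = g n) _ (fn_shift Ht)).
exact: (ar_ren (fun i => if i is 0 then 1 else 0) Hg).
Qed.

Lemma fn2 (g : nat -> nat -> nat) t u :
  arith_fn (fun _ e => g (e 0) (e 1)) -> arith_fn t -> arith_fn u -> arith_fn (fun f e => g (t f e) (u f e)).
Proof.
move=> Hg Ht Hu; apply: (@ar3 (fun x y z => z = g x y)) => //.
- exact: (ar_ren (fun i => match i with 0 => 2 | 1 => 0 | _ => 1 end) Hg).
- exact: fn_shift.
- exact: fn_shift.
- exact: (fn_term (Var 0)).
Qed.

Lemma fn_var i : arith_fn (fun _ e => e i).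
Proof. exact: (fn_term (Var i)). Qed.

Lemma fn_const c : arith_fn (fun _ _ => c).
Proof.
suff [t Ht] : exists t, forall f e, teval f e t = c.
  by apply: ar_iff (fn_term t) => f e; rewrite Ht.
by elim: c => [|c [t Ht]]; [exists Zero | exists (Succ t) => f e /=; rewrite Ht].
Qed.

Lemma fn_S t : arith_fn t -> arith_fn (fun f e => (t f e).+1).
Proof. exact: (@fn1 S) (fn_term (Succ (Var 0))). Qed.

Lemma fn_add t u : arith_fn t -> arith_fn u -> arith_fn (fun f e => t f e + u f e).
Proof. exact: (@fn2 addn) (fn_term (Plus (Var 0) (Var 1))). Qed.

Lemma fn_mul t u : arith_fn t -> arith_fn u -> arith_fn (fun f e => t f e * u f e).
Proof. exact: (@fn2 muln) (fn_term (Times (Var 0) (Var 1))). Qed.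

Lemma fn_app t : arith_fn t -> arith_fn (fun f e => f (t f e)).
Proof.
move=> Ht; apply: (@ar_let (fun f e n => e 0 = f n) _ (fn_shift Ht)).
by exists (Eq (Var 1) (App (Var 0))).
Qed.

Lemma ar_leq t u : arith_fn t -> arith_fn u -> arith (fun f e => t f e <= u f e).
Proof.
apply: (@ar2 (fun m n => m <= n)); exists (Ex (Eq (Plus (Var 1) (Var 0)) (Var 2))) => f e /=.
by split=> [H|[k <-]]; [exists (e 1 - e 0); rewrite subnKC | rewrite leq_addr].
Qed.

Ltac fn_step :=
  lazymatch goal with
  | |- arith_fn (fun f e => e ?i) => exact: fn_var
  | |- arith_fn (fun f e => f (@?t f e)) => apply: fn_app
  | |- arith_fn (fun f e => S (@?t f e)) => first [exact: fn_const | apply: fn_S]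
  | |- arith_fn (fun f e => @?t f e + @?u f e) => apply: fn_add
  | |- arith_fn (fun f e => @?t f e * @?u f e) => apply: fn_mul
  | |- arith_fn (fun f e => ?c) => exact: fn_const
  end.

(** Hooks, redefined later for functions on codes and for relations between strings. *)
Ltac ar_ext := fail.
Ltac fn_ext := fail.

Ltac ar_step :=
  cbv beta;
  lazymatch goal with
  | |- arith_fn _ => first [fn_step | fn_ext]
  | |- arith (fun f e => _ /\ _) => apply: ar_and
  | |- arith (fun f e => _ \/ _) => apply: ar_or
  | |- arith (fun f e => ~ _) => apply: ar_not
  | |- arith (fun f e => forall n : nat, _) => apply: ar_all
  | |- arith (fun f e => exists n : nat, _) => apply: ar_ex
  | |- arith (fun f e => _ = _ :> nat) => apply: ar_eq
  | |- arith (fun f e => is_true (_ <= _)) => apply: ar_leq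
  | |- arith (fun f e => _ -> _) => apply: ar_imp
  | |- arith _ => ar_ext
  end.

Ltac ar_tac := repeat ar_step.

(** The function put in place of [f] is only arithmetical, not a term, so nested applications are
    unfolded through graphs. It may read the environment, hence the shifts when the induction passes
    a quantifier. *)
Lemma ar_comp P (F : (nat -> nat) -> (nat -> nat) -> nat -> nat) :
  arith P -> arith_fn (fun f e => F f (shift e) (e 0)) -> arith (fun f e => P (F f e) e).
Proof.
move=> [p Hp] HF; apply: (@ar_iff _ (fun f e => sat (F f e) e p)); first by move=> f e.
move=> {Hp P}.
have term G t : arith_fn (fun f e => G f (shift e) (e 0)) -> arith_fn (fun f e => teval (G f e) e t).
  move=> HG; elim: t => [i||t IH|t IHt u IHu|t IHt u IHu|t IH] /=; ar_tac => //.
  apply: (@ar_let (fun f e n => e 0 = G f (shift e) n) _ (fn_shift IH)).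
  exact: (ar_ren (fun i => match i with 0 => 1 | 1 => 0 | j => j end) HG).
elim: p F HF => /= [t u|p IH|p IHp q IHq|p IHp q IHq|p IHp q IHq|p IH|p IH] F HF.
- by apply: ar_eq; apply: term.
- by apply: ar_not; apply: IH.
- by apply: ar_and; [apply: IHp|apply: IHq].
- by apply: ar_or; [apply: IHp|apply: IHq].
- by apply: ar_imp; [apply: IHp|apply: IHq].
- apply: ar_all; apply: ar_iff (IH (fun f e => F f (shift e)) _).
    by move=> f e; rewrite scons_shift.
  exact: (ar_ren (fun i => match i with 0 => 0 | 1 => 1 | j => j.+1 end) HF).
- apply: ar_ex; apply: ar_iff (IH (fun f e => F f (shift e)) _).
    by move=> f e; rewrite scons_shift.
  exact: (ar_ren (fun i => match i with 0 => 0 | 1 => 1 | j => j.+1 end) HF).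
Qed.

(** * Coding of finite sequences *)

Lemma chinese_seq (m g : nat -> nat) n :
  (forall i j, j < i < n -> coprime (m i) (m j)) ->
  exists c, forall i, i < n -> c = g i %[mod m i].
Proof.
elim: n => [|n IH] co; first by exists 0.
have [|c Hc] := IH; first by move=> i j /andP[ji i_n]; apply: co; rewrite ji ltnW.
have con : coprime (\prod_(j < n) m j) (m n).
  rewrite coprime_sym; apply: (big_ind (fun x => coprime (m n) x)).
  - exact: coprimen1.
  - by move=> x y Hx Hy; rewrite coprimeMr Hx.
  - by move=> j _; apply: co; rewrite ltn_ord ltnSn.
exists (chinese (\prod_(j < n) m j) (m n) c (g n)) => i.
rewrite ltnS leq_eqVlt => /predU1P[->|i_n]; first exact: chinese_modr.
rewrite -(Hc i i_n).
have mi : m i %| \prod_(j < n) m j by rewrite (bigD1 (Ordinal i_n)) //= dvdn_mulr.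
by rewrite -(modn_dvdm _ mi) chinese_modl // modn_dvdm.
Qed.

(* Goedel's beta function. *)
Definition beta (u i : nat) : nat :=
  (Cantor.of_nat u).1 %% (i.+1 * (Cantor.of_nat u).2).+1.

Lemma beta_exists (g : nat -> nat) n : exists u, forall i, i < n -> beta u i = g i.
Proof.
(* The summand [n] makes every difference [i - j] divide the factorial, so the moduli are pairwise
   coprime; the sum of the values makes each modulus exceed the value to be coded. *)
pose d := (\sum_(i < n) g i + n)`!.
have d_ge : \sum_(i < n) g i + n <= d by exact: fact_geq.
have [i j /andP[ji i_n]|c Hc] := @chinese_seq (fun i => (i.+1 * d).+1) g n.
  rewrite /coprime -dvdn1; set r := gcdn _ _.
  have ri : r %| (i.+1 * d).+1 by rewrite dvdn_gcdl.
  have rj : r %| (j.+1 * d).+1 by rewrite dvdn_gcdr.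
  have rij : r %| i - j.
    have -> : i - j = i.+1 * (j.+1 * d).+1 - j.+1 * (i.+1 * d).+1 by lia.
    by rewrite dvdn_sub // dvdn_mull.
  have rd : r %| d by apply: dvdn_trans rij _; apply: dvdn_fact; lia.
  by rewrite -(@dvdn_addr (i.+1 * d)) ?dvdn_mull // addn1.
exists (Cantor.to_nat (c, d)) => i i_n.
rewrite /beta Cantor.cancel_of_to /= Hc // modn_small // ltnS.
have : g i <= \sum_(i < n) g i by rewrite (bigD1 (Ordinal i_n)) //= leq_addr.
by nia.
Qed.

(** With the length stored at position 0, the number 0 codes the empty sequence; it is the root of
    the tree in [pi_tree]. *)
Lemma beta0 i : beta 0 i = 0.
Proof. by rewrite /beta mod0n. Qed.

Lemma pair_codeE x y : (pair_code x y).*2 = y.*2 + (x + y) * (x + y).+1.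
Proof. by have := Cantor.to_nat_spec x y; rewrite /pair_code; lia. Qed.

Lemma pair_code_inj x y x' y' : pair_code x y = pair_code x' y' -> x = x' /\ y = y'.
Proof. by move=> /Cantor.to_nat_inj [-> ->]. Qed.

Lemma leq_pair_code x y : x <= pair_code x y /\ y <= pair_code x y.
Proof. have := pair_codeE x y; split; nia. Qed.

Lemma fn_pair_code t u : arith_fn t -> arith_fn u -> arith_fn (fun f e => pair_code (t f e) (u f e)).
Proof.
apply: fn2; rewrite /arith_fn.
apply: (@ar_iff _ (fun _ e => e 0 + e 0 = e 2 + e 2 + (e 1 + e 2) * (e 1 + e 2).+1)).
  by move=> f e; have := pair_codeE (e 1) (e 2); lia.
by ar_tac.
Qed.

Lemma fn_beta t u : arith_fn t -> arith_fn u -> arith_fn (fun f e => beta (t f e) (u f e)).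
Proof.
apply: fn2; rewrite /arith_fn.
apply: (@ar_iff _ (fun _ e => exists c d, pair_code c d = e 1 /\
   (exists q, c = q * (1 + (e 2).+1 * d) + e 0) /\ e 0 <= (e 2).+1 * d)).
  move=> f e; rewrite /beta; split=> [->|[c [d [<- [[q ->] le]]]]].
    case E: (Cantor.of_nat (e 1)) => [c d] /=; exists c, d; split; last split.
    - by rewrite /pair_code -E Cantor.cancel_to_of.
    - by exists (c %/ (1 + (e 2).+1 * d)); exact: divn_eq.
    - by rewrite -ltnS ltn_mod.
  by rewrite /pair_code Cantor.cancel_of_to /= modnMDl modn_small.
do 2 apply: ar_ex; apply: ar_and; last by ar_tac.
by apply: ar_eq; [apply: fn_pair_code|]; ar_tac.
Qed.

Definition p1 (q : nat) : nat := (Cantor.of_nat q).1.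
Definition p2 (q : nat) : nat := (Cantor.of_nat q).2.

Lemma pair_codeK q : pair_code (p1 q) (p2 q) = q.
Proof. by rewrite /pair_code /p1 /p2 -surjective_pairing Cantor.cancel_to_of. Qed.

Lemma p1K x y : p1 (pair_code x y) = x.
Proof. by rewrite /p1 /pair_code Cantor.cancel_of_to. Qed.

Lemma p2K x y : p2 (pair_code x y) = y.
Proof. by rewrite /p2 /pair_code Cantor.cancel_of_to. Qed.

Lemma fn_p1 t : arith_fn t -> arith_fn (fun f e => p1 (t f e)).
Proof.
apply: fn1; apply: (@ar_iff _ (fun _ e => exists d, pair_code (e 0) d = e 1)); last first.
  by ar_tac; apply: fn_pair_code; ar_tac.
move=> f e; split=> [->|[d <-]]; last by rewrite p1K.
by exists (p2 (e 1)); rewrite pair_codeK.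
Qed.

Lemma fn_p2 t : arith_fn t -> arith_fn (fun f e => p2 (t f e)).
Proof.
apply: fn1; apply: (@ar_iff _ (fun _ e => exists d, pair_code d (e 0) = e 1)); last first.
  by ar_tac; apply: fn_pair_code; ar_tac.
move=> f e; split=> [->|[d <-]]; last by rewrite p2K.
by exists (p1 (e 1)); rewrite pair_codeK.
Qed.

Lemma fn_expn2 t : arith_fn t -> arith_fn (fun f e => 2 ^ t f e).
Proof.
apply: fn1; rewrite /arith_fn.
apply: (@ar_iff _ (fun _ e => exists u, beta u 0 = 1 /\
   (forall i, i < e 1 -> beta u i.+1 = 2 * beta u i) /\ beta u (e 1) = e 0)); last first.
  by ar_tac; apply: fn_beta; ar_tac.
move=> f e; split=> [->|[u [u0 [uS <-]]]].
  have [u Hu] := beta_exists (expn 2) (e 1).+1.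
  exists u; rewrite !Hu //; split=> //; split=> // i i_n; rewrite !Hu ?expnS //; exact: leqW.
suff: forall i, i <= e 1 -> beta u i = 2 ^ i by apply.
by elim=> // i IH i_n; rewrite uS // IH ?expnS // ltnW.
Qed.

(** * Binary strings and their codes *)

Lemma str_code_surj n : exists s, str_code s = n.
Proof.
elim/ltn_ind: n => -[|n] IH; first by exists [::].
have [s Hs] : exists s, str_code s = n./2 by apply: IH; lia.
by exists (odd n :: s) => /=; rewrite Hs; lia.
Qed.

Definition str_of (n : nat) : seq bool := sval (cid (str_code_surj n)).

Lemma str_ofK n : str_code (str_of n) = n.
Proof. by rewrite /str_of; case: cid. Qed.

Lemma str_code_inj : injective str_code.
Proof.
elim=> [|b s IH] [|b' s'] //= H; try lia.
have E : b = b' by move: H; case: b; case: b' => //=; lia.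
by move: H; rewrite E => H; rewrite (IH s') //; lia.
Qed.

Lemma str_codeK s : str_of (str_code s) = s.
Proof. by apply: str_code_inj; rewrite str_ofK. Qed.

Lemma size_str_code s : 2 ^ size s <= (str_code s).+1 < 2 ^ (size s).+1.
Proof. by elim: s => //= b s /andP[IH1 IH2]; rewrite !expnS in IH2 *; case: b; lia. Qed.

Lemma nth_str_code s i : i < size s ->
  exists q r, (str_code s).+1 = (q * 2 + nth false s i) * 2 ^ i + r /\ r < 2 ^ i.
Proof.
elim: s i => //= b s IH [|i] i_s /=.
  by exists (str_code s).+1, 0; case: b; rewrite expn0; lia.
have [q [r [E lt]]] := IH i i_s.
by exists q, (r.*2 + b); rewrite expnS; case: b; nia.
Qed.

Definition csize (c : nat) : nat := size (str_of c).
Definition cbit (c i : nat) : nat := nth false (str_of c) i.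

Lemma leq_csize c : csize c <= c.
Proof.
have := size_str_code (str_of c); rewrite str_ofK -/(csize c).
have := ltn_expl (csize c) (ltnSn 1); lia.
Qed.
Lemma fn_csize t : arith_fn t -> arith_fn (fun f e => csize (t f e)).
Proof.
apply: fn1; rewrite /arith_fn.
apply: (@ar_iff _ (fun _ e => 2 ^ (e 0) <= (e 1).+1 /\ (e 1).+1 < 2 ^ (e 0).+1)); last first.
  by ar_tac; apply: fn_expn2; ar_tac.
move=> f e; have := size_str_code (str_of (e 1)); rewrite str_ofK -/(csize (e 1)).
move=> /andP[H1 H2]; split=> [->|[H3 H4]]; first by rewrite H1 H2.
have := leq_ltn_trans H1 H4; have := leq_ltn_trans H3 H2.
by rewrite !ltn_exp2l //; lia.
Qed.

Lemma fn_cbit t u : arith_fn t -> arith_fn u -> arith_fn (fun f e => cbit (t f e) (u f e)).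
Proof.
apply: fn2; rewrite /arith_fn.
apply: (@ar_iff _ (fun _ e =>
   (e 2 < csize (e 1) /\ e 0 <= 1 /\
    exists q r, (e 1).+1 = (q * 2 + e 0) * 2 ^ (e 2) + r /\ r < 2 ^ (e 2)) \/
   (csize (e 1) <= e 2 /\ e 0 = 0))); last first.
  by ar_tac; first [apply: fn_csize | apply: fn_expn2]; ar_tac.
move=> f e; rewrite /cbit; have [ge|lt] := leqP (csize (e 1)) (e 2).
  by rewrite nth_default //; split=> [->|[[]|[]]//]; right.
have [q [r [E lr]]] := nth_str_code lt; rewrite str_ofK in E.
split=> [->|[[_ [le1 [q' [r' [E' lr']]]]]|[]//]].
  by left; split=> //; split; [case: nth|exists q, r].
have p0 : 0 < 2 ^ e 2 by rewrite expn_gt0.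
have := congr1 (divn^~ (2 ^ e 2)) (etrans (esym E) E').
by rewrite !divnMDl // !divn_small // => Eq; move: le1 Eq; case: nth => /=; lia.
Qed.

Ltac fn_ext ::=
  match goal with
  | |- arith_fn (fun f e => pair_code _ _) => apply: fn_pair_code
  | |- arith_fn (fun f e => beta _ _) => apply: fn_beta
  | |- arith_fn (fun f e => 2 ^ _) => apply: fn_expn2
  | |- arith_fn (fun f e => csize _) => apply: fn_csize
  | |- arith_fn (fun f e => cbit _ _) => apply: fn_cbit
  | |- arith_fn (fun f e => p1 _) => apply: fn_p1
  | |- arith_fn (fun f e => p2 _) => apply: fn_p2
  end.

(** * Relations that are Pi11 *)

Definition pi11 (P : (nat -> nat) -> Prop) : Prop :=
  exists2 Q, arith Q & forall e, P e <-> forall f, Q f e.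

Lemma pi_iff (P Q : (nat -> nat) -> Prop) : (forall e, P e <-> Q e) -> pi11 Q -> pi11 P.
Proof. by move=> PQ [A arA HA]; exists A => // e; rewrite PQ. Qed.

Lemma pi_forall Q : arith Q -> pi11 (fun e => forall f, Q f e).
Proof. by move=> H; exists Q. Qed.

Lemma pi_ar (P : (nat -> nat) -> Prop) : arith (fun _ e => P e) -> pi11 P.
Proof. by move=> H; exists (fun _ e => P e) => // e; split=> // /(_ id). Qed.

Lemma pi_ren (r : nat -> nat) P : pi11 P -> pi11 (fun e => P (fun i => e (r i))).
Proof. by move=> [Q arQ H]; exists (fun f e => Q f (fun i => e (r i))) => //; apply: ar_ren. Qed.

Lemma pi_and P Q : pi11 P -> pi11 Q -> pi11 (fun e => P e /\ Q e).
Proof.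
move=> [A arA HA] [B arB HB]; exists (fun f e => A f e /\ B f e); first exact: ar_and.
by move=> e; rewrite HA HB; split=> [[Ae Be] f|H]; split=> // f; case: (H f).
Qed.

Lemma pi_imp (P Q : (nat -> nat) -> Prop) :
  arith (fun _ e => P e) -> pi11 Q -> pi11 (fun e => P e -> Q e).
Proof.
move=> arP [B arB HB]; exists (fun f e => P e -> B f e); first exact: ar_imp.
by move=> e; rewrite HB; split=> H ? ?; apply: H.
Qed.

Lemma pi_all (P : (nat -> nat) -> nat -> Prop) :
  pi11 (fun e => P (shift e) (e 0)) -> pi11 (fun e => forall n, P e n).
Proof.
move=> [Q arQ H]; exists (fun f e => forall n, Q f (scons n e)).
  by apply: ar_all; apply: ar_iff arQ => f e; rewrite scons_shift.
move=> e; split=> [He f n|He n].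
  by move: (He n) f; apply: (proj1 (H (scons n e))).
by apply: (proj2 (H (scons n e))) => f.
Qed.

(** An injective polynomial pairing: it unfolds to a term, and it is strictly increasing in [x], so
    that an initial segment of the glued function determines initial segments of its components. *)
Definition inter (a x : nat) : nat := (a + x) * (a + x) + x.

Lemma inter_inj a x b y : inter a x = inter b y -> a = b /\ x = y.
Proof. by rewrite /inter => H; have E : a + x = b + y; nia. Qed.

(* A sequence of functions is coded by the single function [inter a x |-> f a x]. *)
Lemma glue_exists (f : nat -> nat -> nat) : exists F, forall a x, F (inter a x) = f a x.
Proof.
pose P m ax := m = inter ax.1 ax.2.
exists (fun m => if pselect (exists ax, P m ax) is left H then let ax := sval (cid H) in f ax.1 ax.2
                 else 0) => a x.
case: pselect => [H|[]]; last by exists (a, x).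
by case: cid => -[b y] /= /inter_inj[-> ->].
Qed.

(** The number quantifier moves inside the function quantifier: if every [n] had a counterexample,
    countable choice would glue these into one function refuting all [n] at once. *)
Lemma pi_ex (P : (nat -> nat) -> nat -> Prop) :
  pi11 (fun e => P (shift e) (e 0)) -> pi11 (fun e => exists n, P e n).
Proof.
move=> [Q arQ H].
exists (fun f e => exists n, Q (fun x => f (inter n x)) (scons n e)).
  apply: ar_ex; have := @ar_comp Q (fun f e x => f (inter (e 0) x)) arQ.
  move=> H1; apply: ar_iff (H1 _); first by move=> f e; rewrite scons_shift.
  by rewrite /inter; ar_tac.
move=> e; split=> [[n Pn] f|He].
  by exists n; apply: (proj1 (H (scons n e)) Pn).
apply: contrapT => no.
have /choice [f Hf] : forall n, exists g, ~ Q g (scons n e).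
  move=> n; apply/existsNP => all; apply: no; exists n.
  exact: (proj2 (H (scons n e))).
have [F HF] := glue_exists f.
have [n] := He F.
have -> : (fun x => F (inter n x)) = f n by apply: funext => x.
exact: Hf.
Qed.

Lemma pi_or P Q : pi11 P -> pi11 Q -> pi11 (fun e => P e \/ Q e).
Proof.
move=> HP HQ; apply: (@pi_iff _ (fun e => exists n, (n = 0 -> P e) /\ (~ n = 0 -> Q e))).
  move=> e; split=> [[Pe|Qe]|[[|n] [H1 H2]]]; [by exists 0|by exists 1|left|right]; auto.
apply: pi_ex; apply: pi_and; apply: pi_imp; [ar_tac|exact: pi_ren|ar_tac|exact: pi_ren].
Qed.

Lemma pi_let (Q : (nat -> nat) -> nat -> Prop) t :
  arith_fn (fun _ e => t e) -> pi11 (fun e => Q (shift e) (e 0)) -> pi11 (fun e => Q e (t e)).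
Proof.
move=> Ht HQ; apply: (@pi_iff _ (fun e => exists n, n = t e /\ Q e n)).
  by move=> e; split=> [H|[n [-> //]]]; exists (t e).
by apply: pi_ex; apply: pi_and => //; apply: pi_ar.
Qed.

Lemma pi1 (P : nat -> Prop) t : pi11 (fun e => P (e 0)) -> arith_fn (fun _ e => t e) -> pi11 (fun e => P (t e)).
Proof. by move=> HP Ht; apply: (@pi_let (fun _ n => P n) _ Ht). Qed.

Lemma pi2 (P : nat -> nat -> Prop) t u :
  pi11 (fun e => P (e 0) (e 1)) -> arith_fn (fun _ e => t e) -> arith_fn (fun _ e => u e) ->
  pi11 (fun e => P (t e) (u e)).
Proof.
move=> HP Ht Hu; apply: (@pi_let (fun e n => P n (u e)) _ Ht).
apply: (@pi_let (fun e n => P (e 0) n) _ (fn_shift Hu)).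
exact: (pi_ren (fun i => if i is 0 then 1 else 0) HP).
Qed.

Lemma pi3 (P : nat -> nat -> nat -> Prop) t u v :
  pi11 (fun e => P (e 0) (e 1) (e 2)) ->
  arith_fn (fun _ e => t e) -> arith_fn (fun _ e => u e) -> arith_fn (fun _ e => v e) ->
  pi11 (fun e => P (t e) (u e) (v e)).
Proof.
move=> HP Ht Hu Hv; apply: (@pi_let (fun e n => P n (u e) (v e)) _ Ht).
apply: (@pi_let (fun e n => P (e 0) n (v (shift e))) _ (fn_shift Hu)).
apply: (@pi_let (fun e n => P (e 1) (e 0) n) _ (fn_shift (fn_shift Hv))).
exact: (pi_ren (fun i => match i with 0 => 2 | 1 => 1 | _ => 0 end) HP).
Qed.

Lemma pi4 (P : nat -> nat -> nat -> nat -> Prop) t u v w :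
  pi11 (fun e => P (e 0) (e 1) (e 2) (e 3)) ->
  arith_fn (fun _ e => t e) -> arith_fn (fun _ e => u e) -> arith_fn (fun _ e => v e) ->
  arith_fn (fun _ e => w e) ->
  pi11 (fun e => P (t e) (u e) (v e) (w e)).
Proof.
move=> HP Ht Hu Hv Hw; apply: (@pi_let (fun e n => P n (u e) (v e) (w e)) _ Ht).
apply: (@pi_let (fun e n => P (e 0) n (v (shift e)) (w (shift e))) _ (fn_shift Hu)).
apply: (@pi_let (fun e n => P (e 1) (e 0) n (w (fun i => e i.+2))) _ (fn_shift (fn_shift Hv))).
apply: (@pi_let (fun e n => P (e 2) (e 1) (e 0) n) _ (fn_shift (fn_shift (fn_shift Hw)))).
exact: (pi_ren (fun i => match i with 0 => 3 | 1 => 2 | 2 => 1 | _ => 0 end) HP).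
Qed.

Ltac pi_ext :=
  match goal with
  | H : pi11 (fun e => ?P (e 0)) |- pi11 (fun e => ?P _) => apply: (pi1 H)
  | H : pi11 (fun e => ?P (e 0) (e 1)) |- pi11 (fun e => ?P _ _) => apply: (pi2 H)
  | H : pi11 (fun e => ?P (e 0) (e 1) (e 2)) |- pi11 (fun e => ?P _ _ _) => apply: (pi3 H)
  end.

Ltac pi_step :=
  cbv beta;
  lazymatch goal with
  | |- pi11 (fun e => _ /\ _) => apply: pi_and
  | |- pi11 (fun e => _ \/ _) => apply: pi_or
  | |- pi11 (fun e => forall n : nat, _) => apply: pi_all
  | |- pi11 (fun e => exists n : nat, _) => apply: pi_ex
  | |- pi11 (fun e => is_true _ -> _) => apply: pi_imp
  | |- pi11 (fun e => _ = _ -> _) => apply: pi_imp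
  | |- pi11 (fun e => _ = _ :> nat) => apply: pi_ar
  | |- pi11 (fun e => ~ (_ = _ :> nat)) => apply: pi_ar
  | |- pi11 (fun e => is_true _) => apply: pi_ar
  | |- pi11 _ => pi_ext
  | |- _ => ar_step
  end.
Ltac pi_tac := repeat pi_step.

(** * Relations that are Delta11 on a Pi11 domain *)

(** The complement of [P] is taken inside [D], since the norm compares with [m] in a Delta11 way
    only when [m] is in the Pi11 set. *)
Definition delta11 (D P : (nat -> nat) -> Prop) : Prop :=
  pi11 (fun e => D e /\ P e) /\ pi11 (fun e => D e /\ ~ P e).

Lemma dl_pi D P : delta11 D P -> pi11 (fun e => D e /\ P e).
Proof. by case. Qed.

Lemma dl_ar D (P : (nat -> nat) -> Prop) : pi11 D -> arith (fun _ e => P e) -> delta11 D P.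
Proof. by move=> HD HP; split; apply: pi_and => //; apply: pi_ar => //; apply: ar_not. Qed.

Lemma dl_not D P : delta11 D P -> delta11 D (fun e => ~ P e).
Proof. by move=> [H1 H2]; split=> //; apply: pi_iff H1 => e; rewrite notK. Qed.

Lemma dl_and D P Q : delta11 D P -> delta11 D Q -> delta11 D (fun e => P e /\ Q e).
Proof.
move=> [P1 P2] [Q1 Q2]; split; [apply: pi_iff (pi_and P1 Q1) | apply: pi_iff (pi_or P2 Q2)] => e.
  by tauto.
by rewrite not_andE; tauto.
Qed.

Lemma dl_imp D P Q : delta11 D P -> delta11 D Q -> delta11 D (fun e => P e -> Q e).
Proof.
move=> [P1 P2] [Q1 Q2]; split; [apply: pi_iff (pi_or P2 Q1) | apply: pi_iff (pi_and P1 Q2)] => e.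
  by have := pselect (P e); tauto.
by have := pselect (P e); have := pselect (Q e); tauto.
Qed.

Lemma dl_ex (D : (nat -> nat) -> Prop) (P : (nat -> nat) -> nat -> Prop) :
  delta11 (fun e => D (shift e)) (fun e => P (shift e) (e 0)) -> delta11 D (fun e => exists n, P e n).
Proof.
move=> [H1 H2]; split.
  by apply: pi_iff (pi_ex (P := fun e n => D e /\ P e n) H1) => e; firstorder.
apply: pi_iff (pi_all (P := fun e n => D e /\ ~ P e n) H2) => e; split=> [[De nP] n|H].
  by split=> // Pn; apply: nP; exists n.
by split=> [|[n Pn]]; [case: (H 0)|case: (H n)].
Qed.

Lemma dl_all (D : (nat -> nat) -> Prop) (P : (nat -> nat) -> nat -> Prop) :
  delta11 (fun e => D (shift e)) (fun e => P (shift e) (e 0)) -> delta11 D (fun e => forall n, P e n).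
Proof.
move=> [H1 H2]; split.
  by apply: pi_iff (pi_all (P := fun e n => D e /\ P e n) H1) => e; split=> [[]//|H];
     split=> [|n]; [case: (H 0)|case: (H n)].
apply: pi_iff (pi_ex (P := fun e n => D e /\ ~ P e n) H2) => e.
by split=> [[De /existsNP[n nP]]|[n [De nP]]]; [exists n|split=> // /(_ n)].
Qed.

Lemma dl_iff D (P Q : (nat -> nat) -> Prop) : (forall e, P e <-> Q e) -> delta11 D Q -> delta11 D P.
Proof. by move=> PQ [H1 H2]; split; [apply: pi_iff H1|apply: pi_iff H2] => e; rewrite PQ. Qed.

Lemma dl3 (D : nat -> nat -> Prop) (P : nat -> nat -> nat -> Prop) t u v :
  delta11 (fun e => D (e 0) (e 1)) (fun e => P (e 0) (e 1) (e 2)) ->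
  arith_fn (fun _ e => t e) -> arith_fn (fun _ e => u e) -> arith_fn (fun _ e => v e) ->
  delta11 (fun e => D (t e) (u e)) (fun e => P (t e) (u e) (v e)).
Proof.
move=> [H1 H2] Ht Hu Hv.
by split; [apply: (@pi3 (fun x y z => D x y /\ P x y z))
          |apply: (@pi3 (fun x y z => D x y /\ ~ P x y z))].
Qed.

Lemma dl4 (D : nat -> nat -> Prop) (P : nat -> nat -> nat -> nat -> Prop) t u v w :
  delta11 (fun e => D (e 0) (e 1)) (fun e => P (e 0) (e 1) (e 2) (e 3)) ->
  arith_fn (fun _ e => t e) -> arith_fn (fun _ e => u e) -> arith_fn (fun _ e => v e) ->
  arith_fn (fun _ e => w e) ->
  delta11 (fun e => D (t e) (u e)) (fun e => P (t e) (u e) (v e) (w e)).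
Proof.
move=> [H1 H2] Ht Hu Hv Hw.
by split; [apply: (@pi4 (fun x y z s => D x y /\ P x y z s))
          |apply: (@pi4 (fun x y z s => D x y /\ ~ P x y z s))].
Qed.

Ltac dl_step :=
  cbv beta;
  lazymatch goal with
  | |- delta11 _ (fun e => _ /\ _) => apply: dl_and
  | |- delta11 _ (fun e => ~ _) => apply: dl_not
  | |- delta11 _ (fun e => forall n : nat, _) => apply: dl_all
  | |- delta11 _ (fun e => exists n : nat, _) => apply: dl_ex
  | |- delta11 _ (fun e => _ = _ :> nat) => apply: dl_ar
  | |- delta11 _ (fun e => is_true _) => apply: dl_ar
  | |- delta11 _ (fun e => _ -> _) => apply: dl_imp
  | H : delta11 (fun e => ?D (e 0) (e 1)) (fun e => ?P (e 0) (e 1) (e 2))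
    |- delta11 (fun e => ?D _ _) (fun e => ?P _ _ _) => apply: (dl3 H)
  | H : delta11 (fun e => ?D (e 0) (e 1)) (fun e => ?P (e 0) (e 1) (e 2) (e 3))
    |- delta11 (fun e => ?D _ _) (fun e => ?P _ _ _ _) => apply: (dl4 H)
  | |- _ => pi_step
  end.

(** * Counting *)

(** A cardinality bound by number quantifiers alone: [u] codes [N] distinct elements. As [P] occurs
    positively, the bound is Pi11 whenever [P] is. *)
Definition atleast (N : nat) (P : nat -> Prop) : Prop :=
  exists u, forall i, i < N -> P (beta u i) /\ forall j, j < i -> ~ beta u i = beta u j.

Lemma atleastP (T : finType) (A : {set T}) (g : T -> nat) N (P : nat -> Prop) :
  injective g -> (forall c, P c <-> exists2 t, t \in A & c = g t) ->
  (N <= #|A| <-> atleast N P).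
Proof.
move=> g_inj HP; split=> [le|[u Hu]].
  have [u Hu] := beta_exists (nth 0 (map g (enum A))) N.
  have sz : size (map g (enum A)) = #|A| by rewrite size_map cardE.
  exists u => i i_N; rewrite Hu //; split.
    have : nth 0 [seq g i | i <- enum A] i \in map g (enum A).
      by rewrite mem_nth // sz (leq_trans i_N).
    by case/mapP=> t; rewrite mem_enum => tA ->; apply/HP; exists t.
  move=> j ji; rewrite Hu ?(ltn_trans ji) // => /eqP.
  rewrite nth_uniq ?sz ?(leq_trans i_N) ?(leq_trans (ltn_trans ji i_N)) //.
    by move=> /eqP E; rewrite E ltnn in ji.
  by rewrite map_inj_uniq ?enum_uniq.
have us : uniq (mkseq (beta u) N).
  apply/mkseq_uniqP => i j; rewrite !inE => iN jN E.
  have [ij|ji|//] := ltngtP i j; first by case: (Hu j jN) => _ /(_ i ij); rewrite E.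
  by case: (Hu i iN) => _ /(_ j ji); rewrite E.
have sub : {subset mkseq (beta u) N <= map g (enum A)}.
  move=> c /mapP[i]; rewrite mem_iota /= add0n => iN ->.
  by have [/HP[t tA ->] _] := Hu i iN; rewrite map_f ?mem_enum.
by have := uniq_leq_size us sub; rewrite size_mkseq size_map cardE.
Qed.

(** * Sigma11 relations as infinite branches *)

Definition finitary (B : (nat -> nat) -> nat -> (nat -> nat) -> Prop) : Prop :=
  forall F F' l e, (forall i, i < l -> F i = F' i) -> B F l e -> B F' l e.

(* [P f e] holds when the tree [B _ _ e] of finite sequences has a branch with component 0 equal
   to [f]; [finitary] makes [B F l e] a property of the first [l] values of [F]. *)
Definition sigma11 (P : (nat -> nat) -> (nat -> nat) -> Prop) : Prop :=
  exists B, [/\ arith (fun F e => B F (e 0) (shift e)), finitary B &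
    forall f e, P f e <-> exists F, (forall x, F (inter 0 x) = f x) /\ forall l, B F l e].

(* [B] holds of the initial segments of the component [a] of [F] that [F] restricted to [l]
   determines, and that component codes the same real as [F] does. *)
Definition component (B : (nat -> nat) -> nat -> (nat -> nat) -> Prop) F a l e : Prop :=
  (forall x, inter a (inter 0 x) < l -> F (inter a (inter 0 x)) = F (inter 0 x)) /\
  (forall l', (forall x, x < l' -> inter a x < l) -> B (fun x => F (inter a x)) l' e).

Lemma leq_inter a x : x <= inter a x.
Proof. exact: leq_addl. Qed.

Lemma ltn_inter a x y : x < y -> inter a x < inter a y.
Proof. by rewrite /inter; nia. Qed.

Lemma component_local B a : finitary B -> finitary (fun F l e => component B F a l e).
Proof.
move=> lB F F' l e FF' [H1 H2]; split=> [x xl|l' l'l].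
  by rewrite -!FF' ?H1 //; apply: leq_ltn_trans xl; exact: leq_inter.
by apply: lB (H2 _ l'l) => i il; apply: FF'; apply: l'l.
Qed.

(** The threshold [c] is there because trees for quantifiers and disjunctions impose their
    conditions only from some level on. *)
Lemma all_component B F a e c : (forall l, c < l -> component B F a l e) ->
  (forall x, F (inter a (inter 0 x)) = F (inter 0 x)) /\
  forall l, B (fun x => F (inter a x)) l e.
Proof.
move=> H; split=> [x|l].
  have [] := H ((inter a (inter 0 x)).+1 + c.+1); first by lia.
  by move=> H1 _; apply: H1; lia.
have [|_] := H (inter a l + c.+1); first by lia.
by apply=> x xl; have := ltn_inter a xl; lia.
Qed.

Lemma component_all B F a e : (forall x, F (inter a (inter 0 x)) = F (inter 0 x)) ->
  (forall l, B (fun x => F (inter a x)) l e) -> forall l, component B F a l e.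
Proof. by []. Qed.

Lemma ar_component B : arith (fun F e => B F (e 0) (shift e)) ->
  arith (fun F e => component B F (e 0) (e 1) (fun i => e i.+2)).
Proof.
move=> HB; apply: ar_and; first by rewrite /inter; ar_tac.
apply: ar_all; apply: ar_imp; first by rewrite /inter; ar_tac.
have HB3 := ar_ren (fun i => if i is j.+1 then j.+3 else 0) HB.
apply: (ar_comp (F := fun f e x => f (inter (e 1) x)) HB3).
by rewrite /inter; ar_tac.
Qed.

Lemma sigma_iff (P Q : (nat -> nat) -> (nat -> nat) -> Prop) :
  (forall f e, P f e <-> Q f e) -> sigma11 Q -> sigma11 P.
Proof. by move=> PQ [B [H1 H2 H3]]; exists B; split=> // f e; rewrite PQ. Qed.

Lemma sigma_const (P : (nat -> nat) -> Prop) : arith (fun _ e => P e) -> sigma11 (fun _ e => P e).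
Proof.
move=> HP; exists (fun _ _ e => P e); split=> //.
  exact: (ar_ren (fun i => i.+1) HP).
move=> f e; split=> [Pe|[F [_ H]]]; last exact: (H 0).
by have [F HF] := glue_exists (fun _ => f); exists F.
Qed.

Lemma sigma_app : sigma11 (fun f e => e 1 = f (e 0)).
Proof.
exists (fun F l e => inter 0 (e 0) < l -> e 1 = F (inter 0 (e 0))); split.
- by rewrite /inter; ar_tac.
- by move=> F F' l e FF' H lt; rewrite -FF' ?H.
move=> f e; split=> [E|[F [F0 H]]]; last by rewrite (H _ (leqnn _)) F0.
by have [F HF] := glue_exists (fun _ => f); exists F; split=> [x|l _]; rewrite ?E HF.
Qed.

Lemma sigma_ren (r : nat -> nat) P : sigma11 P -> sigma11 (fun f e => P f (fun i => e (r i))).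
Proof.
move=> [B [H1 H2 H3]]; exists (fun F l e => B F l (fun i => e (r i))); split=> //.
  exact: (ar_ren (fun i => if i is j.+1 then (r j).+1 else 0) H1).
by move=> F F' l e; apply: H2.
Qed.

Lemma ar_component_const a B : arith (fun F e => B F (e 0) (shift e)) ->
  arith (fun F e => component B F a (e 0) (shift e)).
Proof.
move=> HB; apply: (@ar_let (fun F e n => component B F n (e 0) (shift e)) _ (fn_const a)).
exact: ar_component.
Qed.

Lemma ar_component_scons B : arith (fun F e => B F (e 0) (shift e)) ->
  arith (fun F e => component B F (e 0) (e 2) (scons (e 1) (fun i => e i.+3))).
Proof.
move=> HB; pose r i := match i with 0 => 0 | 1 => 2 | 2 => 1 | j => j end.
apply: ar_iff (ar_ren r (ar_component HB)) => F e.
suff -> : scons (e 1) (fun i => e i.+3) = (fun i => e (r i.+2)) by [].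
by apply: funext; case.
Qed.

Lemma sigma_and P Q : sigma11 P -> sigma11 Q -> sigma11 (fun f e => P f e /\ Q f e).
Proof.
move=> [B [B1 B2 B3]] [C [C1 C2 C3]].
exists (fun F l e => component B F 1 l e /\ component C F 2 l e); split.
- by apply: ar_and; apply: ar_component_const.
- by move=> F F' l e FF' [H1 H2]; split; apply: component_local FF' _.
move=> f e; rewrite B3 C3; split=> [[[F1 [E1 H1]] [F2 [E2 H2]]]|[F [E H]]].
  have [F HF] := glue_exists (fun a => match a with 0 => f | 1 => F1 | _ => F2 end).
  have Fa a : (fun x => F (inter a x)) = (match a with 0 => f | 1 => F1 | _ => F2 end).
    by apply: funext.
  exists F; split=> [x|l]; [exact: HF|split; apply: component_all].
  - by move=> x; rewrite !HF E1.
  - by rewrite (Fa 1).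
  - by move=> x; rewrite !HF E2.
  - by rewrite (Fa 2).
split.
  have [|E1 H1] := @all_component B F 1 e 0; first by move=> l _; case: (H l).
  by exists (fun x => F (inter 1 x)); split=> // x; rewrite E1.
have [|E1 H1] := @all_component C F 2 e 0; first by move=> l _; case: (H l).
by exists (fun x => F (inter 2 x)); split=> // x; rewrite E1.
Qed.

(** Component 1 stores the witness [n] at argument 0, and component 2 a branch for it. The guard
    delays the condition until the stored value lies in the initial segment, which keeps the tree
    finitary. *)
Lemma sigma_ex (P : (nat -> nat) -> (nat -> nat) -> nat -> Prop) :
  sigma11 (fun f e => P f (shift e) (e 0)) -> sigma11 (fun f e => exists n, P f e n).
Proof.
move=> [B [B1 B2 B3]].
exists (fun F l e => inter 1 0 < l -> component B F 2 l (scons (F (inter 1 0)) e)); split.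
- apply: ar_imp; first by rewrite /inter; ar_tac.
  apply: (@ar_let (fun F e n => component B F 2 (e 0) (scons n (shift e)))); first by ar_tac.
  apply: (@ar_let (fun F e n => component B F n (e 1) (scons (e 0) (fun i => e i.+2))) _ (fn_const 2)).
  exact: ar_component_scons.
- move=> F F' l e FF' H lt; rewrite -FF' //; exact: component_local FF' (H lt).
move=> f e; split=> [[n]|[F [E H]]].
  move/(proj1 (B3 f (scons n e))) => [F2 [E2 H2]].
  have [F HF] := glue_exists (fun a => match a with 0 => f | 1 => fun=> n | _ => F2 end).
  have Fa : (fun x => F (inter 2 x)) = F2 by apply: funext => x; rewrite HF.
  exists F; split=> [x|l _]; rewrite HF //; apply: component_all => [x|]; first by rewrite !HF E2.
  by rewrite Fa.
have [|E1 H1] := @all_component B F 2 (scons (F (inter 1 0)) e) (inter 1 0); first by move=> l /H.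
exists (F (inter 1 0)); apply: (proj2 (B3 f (scons (F (inter 1 0)) e))).
by exists (fun x => F (inter 2 x)); split=> // x; rewrite E1.
Qed.

(** Component [n.+1] carries a branch for [n]; countable choice collects these branches. *)
Lemma sigma_all (P : (nat -> nat) -> (nat -> nat) -> nat -> Prop) :
  sigma11 (fun f e => P f (shift e) (e 0)) -> sigma11 (fun f e => forall n, P f e n).
Proof.
move=> [B [B1 B2 B3]].
exists (fun F l e => forall n, n < l -> component B F n.+1 l (scons n e)); split.
- apply: ar_all; apply: ar_imp; first by ar_tac.
  apply: (@ar_let (fun F e n => component B F n (e 1) (scons (e 0) (fun i => e i.+2)))); first by ar_tac.
  exact: ar_component_scons.
- by move=> F F' l e FF' H n nl; apply: component_local FF' (H n nl).
move=> f e; split=> [H|[F [E H]] n].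
  have /choice [G HG] : forall n, exists F, (forall x, F (inter 0 x) = f x) /\
      forall l, B F l (scons n e).
    by move=> n; apply/(proj1 (B3 f (scons n e))); exact: H.
  have [F HF] := glue_exists (fun a => if a is n.+1 then G n else f).
  have Fa n : (fun x => F (inter n.+1 x)) = G n by apply: funext => x; rewrite HF.
  exists F; split=> [x|l n _]; first exact: HF.
  have [E1 H1] := HG n.
  by apply: component_all => [x|]; rewrite ?HF ?E1 // Fa.
have [|E1 H1] := @all_component B F n.+1 (scons n e) n; first by move=> l /H.
apply: (proj2 (B3 f (scons n e))).
by exists (fun x => F (inter n.+1 x)); split=> // x; rewrite E1.
Qed.

Lemma sigma_or P Q : sigma11 P -> sigma11 Q -> sigma11 (fun f e => P f e \/ Q f e).
Proof.
move=> [B [B1 B2 B3]] [C [C1 C2 C3]].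
exists (fun F l e => inter 1 0 < l -> (F (inter 1 0) = 0 -> component B F 2 l e) /\
   (~ F (inter 1 0) = 0 -> component C F 2 l e)); split.
- by rewrite /inter; ar_tac; apply: ar_component_const.
- move=> F F' l e FF' H lt; rewrite -FF' //; have [H1 H2] := H lt.
  by split=> E; [apply: component_local FF' (H1 E)|apply: component_local FF' (H2 E)].
have glue f F1 c e D : (forall x, F1 (inter 0 x) = f x) ->
    (forall l, D F1 l e) -> exists F, [/\ forall x, F (inter 0 x) = f x, F (inter 1 0) = c &
    forall l, component D F 2 l e].
  move=> E2 H2.
  have [F HF] := glue_exists (fun a => match a with 0 => f | 1 => fun=> c | _ => F1 end).
  have Fa : (fun x => F (inter 2 x)) = F1 by apply: funext => x; rewrite HF.
  exists F; split=> [x||]; [exact: HF|exact: HF|apply: component_all => [x|]; first by rewrite !HF E2].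
  by rewrite Fa.
move=> f e; rewrite B3 C3; split=> [[[F1 [E1 H1]]|[F1 [E1 H1]]]|[F [E H]]].
- have [F [F0 F1' F2]] := glue f F1 0 e B E1 H1.
  by exists F; split=> // l _; rewrite F1'; split.
- have [F [F0 F1' F2]] := glue f F1 1 e C E1 H1.
  by exists F; split=> // l _; rewrite F1'; split.
have [F1|F1] := pselect (F (inter 1 0) = 0); [left|right].
  have [|E1 H1] := @all_component B F 2 e (inter 1 0); first by move=> l /H[] /(_ F1).
  by exists (fun x => F (inter 2 x)); split=> // x; rewrite E1.
have [|E1 H1] := @all_component C F 2 e (inter 1 0); first by move=> l /H[] _ /(_ F1).
by exists (fun x => F (inter 2 x)); split=> // x; rewrite E1.
Qed.

Lemma sigma_term t : sigma11 (fun f e => e 0 = teval f (shift e) t).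
Proof.
elim: t => [i||t IH|t IHt u IHu|t IHt u IHu|t IH] /=.
- by apply: sigma_const; ar_tac.
- by apply: sigma_const; ar_tac.
- apply: (@sigma_iff _ (fun f e => exists n, n = teval f (shift e) t /\ e 0 = n.+1)).
    by move=> f e; split=> [->|[n [-> ->]]//]; exists (teval f (shift e) t).
  apply: sigma_ex; apply: sigma_and; last by apply: sigma_const; ar_tac.
  exact: (sigma_ren (fun i => if i is j.+1 then j.+2 else 0) IH).
- apply: (@sigma_iff _ (fun f e => exists n, n = teval f (shift e) t /\
    exists m, m = teval f (shift e) u /\ e 0 = n + m)).
    move=> f e; split=> [->|[n [-> [m [-> ->]]]]//]; exists (teval f (shift e) t); split=> //.
    by exists (teval f (shift e) u).
  apply: sigma_ex; apply: sigma_and; first exact: (sigma_ren (fun i => if i is j.+1 then j.+2 else 0) IHt).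
  apply: sigma_ex; apply: sigma_and; last by apply: sigma_const; ar_tac.
  exact: (sigma_ren (fun i => if i is j.+1 then j.+3 else 0) IHu).
- apply: (@sigma_iff _ (fun f e => exists n, n = teval f (shift e) t /\
    exists m, m = teval f (shift e) u /\ e 0 = n * m)).
    move=> f e; split=> [->|[n [-> [m [-> ->]]]]//]; exists (teval f (shift e) t); split=> //.
    by exists (teval f (shift e) u).
  apply: sigma_ex; apply: sigma_and; first exact: (sigma_ren (fun i => if i is j.+1 then j.+2 else 0) IHt).
  apply: sigma_ex; apply: sigma_and; last by apply: sigma_const; ar_tac.
  exact: (sigma_ren (fun i => if i is j.+1 then j.+3 else 0) IHu).
- apply: (@sigma_iff _ (fun f e => exists n, n = teval f (shift e) t /\ e 0 = f n)).
    by move=> f e; split=> [->|[n [-> ->]]//]; exists (teval f (shift e) t).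
  apply: sigma_ex; apply: sigma_and.
    exact: (sigma_ren (fun i => if i is j.+1 then j.+2 else 0) IH).
  exact: sigma_app.
Qed.

Lemma sigma_terms (P : nat -> nat -> Prop) t u : arith (fun _ e => P (e 0) (e 1)) ->
  sigma11 (fun f e => P (teval f e t) (teval f e u)).
Proof.
move=> HP; apply: (@sigma_iff _ (fun f e => exists n, n = teval f e t /\
    exists m, m = teval f e u /\ P n m)).
  move=> f e; split=> [H|[n [-> [m [-> //]]]]]; exists (teval f e t); split=> //.
  by exists (teval f e u).
apply: sigma_ex; apply: sigma_and; first exact: sigma_term.
apply: sigma_ex; apply: sigma_and; first exact: (sigma_ren (fun i => if i is j.+1 then j.+2 else 0) (sigma_term u)).
by apply: sigma_const; exact: (ar_ren (fun i => if i is 0 then 1 else 0) HP).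
Qed.

(** Witnesses of the number quantifiers are absorbed into the branch. Formulas are not in negation
    normal form, so truth and falsity go through the induction together. *)
Lemma sigma_sat p : sigma11 (fun f e => sat f e p) /\ sigma11 (fun f e => ~ sat f e p).
Proof.
elim: p => /= [t u|p [P1 P2]|p [P1 P2] q [Q1 Q2]|p [P1 P2] q [Q1 Q2]|p [P1 P2] q [Q1 Q2]
  |p [P1 P2]|p [P1 P2]].
- split; first by apply: (@sigma_terms eq); ar_tac.
  by apply: (@sigma_terms (fun m n => ~ m = n)); ar_tac.
- by split=> //; apply: sigma_iff P1 => f e; rewrite notK.
- split; first exact: sigma_and.
  by apply: sigma_iff (sigma_or P2 Q2) => f e; rewrite not_andE.
- split; first exact: sigma_or.
  by apply: sigma_iff (sigma_and P2 Q2) => f e; rewrite not_orE.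
- split; first by apply: sigma_iff (sigma_or P2 Q1) => f e; rewrite implyE.
  by apply: sigma_iff (sigma_and P1 Q2) => f e; rewrite not_implyE.
- split; first by apply: sigma_all; apply: sigma_iff P1 => f e; rewrite scons_shift.
  apply: (@sigma_iff _ (fun f e => exists n, ~ sat f (scons n e) p)).
    by move=> f e; split=> /existsNP.
  by apply: sigma_ex; apply: sigma_iff P2 => f e; rewrite scons_shift.
- split; first by apply: sigma_ex; apply: sigma_iff P1 => f e; rewrite scons_shift.
  apply: (@sigma_iff _ (fun f e => forall n, ~ sat f (scons n e) p)).
    by move=> f e; split=> /forallNP.
  by apply: sigma_all; apply: sigma_iff P2 => f e; rewrite scons_shift.
Qed.

(** * The tree of a Pi11 set *)

Lemma acc_children (T : Type) (R : T -> T -> Prop) v :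
  ~ Acc R v -> exists2 b, R b v & ~ Acc R b.
Proof.
move=> nA; apply: contrapT => no; apply: nA; constructor=> b bv.
by apply: contrapT => nb; apply: no; exists b.
Qed.

(** Failure of [P e] is the existence of a branch, that is, of an infinite [R e]-descent from the
    root. Nodes are numbers decoded by [beta], which makes [R] arithmetical. *)
Lemma pi_tree (P : (nat -> nat) -> Prop) : pi11 P ->
  exists2 R : (nat -> nat) -> nat -> nat -> Prop,
    arith (fun _ e => R (fun i => e i.+2) (e 0) (e 1)) & forall e, P e <-> Acc (R e) 0.
Proof.
move=> [Q [p Hp] HQ]; have [_ [B [B1 B2 B3]]] := sigma_sat p.
have nP e : ~ P e <-> exists F, forall l, B F l e.
  rewrite HQ -existsNE; split=> [[f nf]|[F HF] ].
    have [F [_ HF]] : exists F, (forall x, F (inter 0 x) = f x) /\ forall l, B F l e.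
      by apply/B3; rewrite -Hp.
    by exists F.
  by exists (fun x => F (inter 0 x)); rewrite Hp; apply/B3; exists F.
(* The node [u] codes the first [beta u 0] values of a function. *)
pose R e v u := beta v 0 = (beta u 0).+1 /\
  (forall x, x < beta u 0 -> beta v x.+1 = beta u x.+1) /\
  forall l, l <= beta v 0 -> B (fun x => beta v x.+1) l e.
exists R.
  apply: ar_and; first by ar_tac.
  apply: ar_and; first by ar_tac.
  apply: ar_all; apply: ar_imp; first by ar_tac.
  have B4 := ar_ren (fun i => if i is j.+1 then j.+3 else 0) B1.
  by apply: (ar_comp (F := fun f e x => beta (e 1) x.+1) B4); ar_tac.
move=> e; split=> [Pe|HA].
  apply: contrapT => nA.
  (* Dependent choice descends through non-accessible nodes. Lengths grow by one at each step, and
     the last entries of these nodes form a branch. *)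
  pose T := {u | ~ Acc (R e) u}.
  have step (u : T) : exists v : T, R e (sval v) (sval u).
    by have [v vu nv] := acc_children (svalP u); exists (exist _ v nv).
  have [s Hs] := choice step.
  pose w n := sval (iter n s (exist _ 0 nA)).
  have wR n : R e (w n.+1) (w n) by exact: Hs.
  have w0 n : beta (w n) 0 = n.
    by elim: n => [|n IH]; [exact: beta0|have [-> _] := wR n; rewrite IH].
  have wS n m x : x < n -> n <= m -> beta (w m) x.+1 = beta (w n) x.+1.
    move=> xn; elim: m => [|m IH]; first by rewrite leqn0 => /eqP E; rewrite E in xn.
    rewrite leq_eqVlt => /predU1P[-> //|nm]; have [_ [H _]] := wR m.
    by rewrite H ?IH // w0; apply: leq_trans xn nm.
  suff /nP : exists F, forall l, B F l e by [].
  exists (fun x => beta (w x.+1) x.+1) => l.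
  have [_ [_ H]] := wR l.
  apply: B2 (H l _) => [i il|]; last by rewrite w0.
  by apply: wS => //; apply: leqW.
apply: contrapT => /nP[F HF].
(* No accessible node lies on the branch [F], because its extension along [F] is a child that lies
   on [F] again. *)
suff H u : Acc (R e) u -> ~ forall x, x < beta u 0 -> beta u x.+1 = F x.
  by apply: (H 0 HA) => x; rewrite beta0.
elim=> {HA}u _ IH Hu.
have [v Hv] := beta_exists (fun i => if i is j.+1 then F j else (beta u 0).+1) (beta u 0).+2.
apply: (IH v); last first.
  by move=> x; rewrite Hv // => xu; rewrite Hv.
split; first by rewrite Hv.
split=> [x xu|l]; first by rewrite Hv ?Hu // ltnS ltnW.
rewrite Hv // => lu; apply: B2 (HF l) => i il; rewrite Hv //.
by lia.
Qed.

(** * Comparison of ranks *)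

Section Sim.
Variables (A B : Type) (R : A -> A -> Prop) (S : B -> B -> Prop).

(* For well-founded [v], [sim u v] compares ranks, rank u <= rank v; unlike a comparison through
   ordinals it is visibly Sigma11. [ssim] is the strict comparison. *)
Definition sim (u : A) (v : B) : Prop :=
  exists Z : A -> B -> Prop, Z u v /\
    forall a b, Z a b -> forall a', R a' a -> exists b', S b' b /\ Z a' b'.

Definition ssim (u : A) (v : B) : Prop := exists b, S b v /\ sim u b.

Lemma sim_step u v a : sim u v -> R a u -> exists b, S b v /\ sim a b.
Proof. by move=> [Z [Zuv H]] au; have [b [bv Zab]] := H u v Zuv a au; exists b; split=> //; exists Z. Qed.

Lemma sim_intro u v : (forall a, R a u -> exists b, S b v /\ sim a b) -> sim u v.
Proof.
move=> H; exists (fun a b => sim a b \/ (a = u /\ b = v)); split; first by right.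
move=> a b [ab|[-> ->]] a' a'a.
  by have [b' [? ?]] := sim_step ab a'a; exists b'; split=> //; left.
by have [b' [? ?]] := H _ a'a; exists b'; split=> //; left.
Qed.

(** An ill-founded node behaves like rank infinity: it always has an ill-founded child to answer
    with. *)
Lemma sim_notacc u v : ~ Acc S v -> sim u v.
Proof.
move=> nv; exists (fun _ b => ~ Acc S b); split=> // _ b nb a' _.
by have [b' ? ?] := acc_children nb; exists b'.
Qed.

Lemma sim_acc u v : Acc S v -> sim u v -> Acc R u.
Proof.
move=> HA; elim: HA u => {}v _ IH u uv; constructor=> a au.
by have [b [bv ab]] := sim_step uv au; apply: (IH b).
Qed.
End Sim.

Lemma sim_refl (A : Type) (R : A -> A -> Prop) u : sim R R u u.
Proof. by exists eq; split=> // a _ <- a' ?; exists a'. Qed.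

Lemma sim_trans (A B C : Type) (R : A -> A -> Prop) (S : B -> B -> Prop) (T : C -> C -> Prop) u v w :
  sim R S u v -> sim S T v w -> sim R T u w.
Proof.
move=> uv vw; exists (fun a c => exists b, sim R S a b /\ sim S T b c); split; first by exists v.
move=> a c [b [ab bc]] a' a'a; have [b' [b'b ab']] := sim_step ab a'a.
by have [c' [c'c bc']] := sim_step bc b'b; exists c'; split=> //; exists b'.
Qed.

Lemma sim_child (A : Type) (R : A -> A -> Prop) u : Acc R u -> forall a, R a u -> sim R R a u.
Proof.
by elim=> {}u _ IH a au; apply: sim_intro => b ba; exists a; split=> //; apply: IH.
Qed.

Lemma ssim_irr (A : Type) (R : A -> A -> Prop) u : Acc R u -> ~ ssim R R u u.
Proof.
elim=> {}u _ IH [b [bu ub]]; apply: (IH b bu).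
by have [c [cb bc]] := sim_step ub bu; exists c.
Qed.

(** If [u] is not simulated by [v], some child [a] of [u] is simulated by no child of [v]; by
    induction each child of [v] is then strictly below [a], so [v] is simulated by [a]. *)
Lemma sim_total (A B : Type) (R : A -> A -> Prop) (S : B -> B -> Prop) u :
  Acc R u -> forall v, sim R S u v \/ ssim S R v u.
Proof.
elim=> {}u _ IH v; have [|nuv] := pselect (sim R S u v); [by left|right].
have [a au na] : exists2 a, R a u & forall b, S b v -> ~ sim R S a b.
  apply: contrapT => no; apply: nuv; apply: sim_intro => a au.
  apply: contrapT => no'; apply: no; exists a => // b bv ab; apply: no'; by exists b.
exists a; split=> //; apply: sim_intro => b bv.
by have [/(na _ bv)//|] := IH a au b.
Qed.

(* The relation [le k m] is Sigma11, and for [m] in [W] it is the negation of the Sigma11 relation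
   "rank m < rank k", hence Delta11. *)
Lemma pi_norm (W : nat -> Prop) : pi11 (fun e => W (e 0)) ->
  exists le : nat -> nat -> Prop,
  [/\ delta11 (fun e => W (e 1)) (fun e => le (e 0) (e 1)),
      forall m, le m m,
      forall k m, W m -> le k m -> W k &
      forall k m, W k -> W m -> (forall x, le x k -> le x m) \/ (forall x, le x m -> le x k)].
Proof.
move=> HW; have [R arR HR] := pi_tree HW.
pose r m := R (fun=> m).
have {}HR m : W m <-> Acc (r m) 0 by have := HR (fun=> m).
have {}arR : arith (fun _ e => r (e 0) (e 1) (e 2)).
  exact: (ar_ren (fun i => match i with 0 => 1 | 1 => 2 | _ => 0 end) arR).
pose le k m := sim (r k) (r m) 0 0.
(* For [k] in [W] this is totality of ranks. For [k] outside [W], the root of its tree has an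
   ill-founded child, which dominates the tree of [m]. *)
have leE k m : W m -> le k m <-> ~ ssim (r m) (r k) 0 0.
  move=> /HR Wm; split=> [km [b [b0 mb]]|nmk].
    have Wk := sim_acc Wm km; apply: (ssim_irr Wk).
    by exists b; split=> //; apply: sim_trans km mb.
  have [Wk|nWk] := pselect (Acc (r k) 0).
    by have [|/nmk] := sim_total (r m) Wk 0.
  have [b b0 nb] := acc_children nWk.
  by case: nmk; exists b; split=> //; apply: sim_notacc.
(* A candidate simulation is represented by the zero set of a function along [inter]. *)
have pi_nsim : pi11 (fun e => ~ sim (r (e 0)) (r (e 1)) (e 2) (e 3)).
  apply: (@pi_iff _ (fun e => forall f, ~ (f (inter (e 2) (e 3)) = 0 /\
    forall a b, f (inter a b) = 0 -> forall a', r (e 0) a' a ->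
    exists b', r (e 1) b' b /\ f (inter a' b') = 0))).
    move=> e; split=> [H f [f0 Hf]|H [Z [Z0 HZ]]].
      by apply: H; exists (fun a b => f (inter a b) = 0).
    have [f Hf] := glue_exists (fun a b => if pselect (Z a b) then 0 else 1).
    apply: (H f); split=> [|a b]; first by rewrite Hf; case: pselect.
    rewrite Hf; case: pselect => // Zab _ a' a'a; have [b' [b'b Z']] := HZ _ _ Zab _ a'a.
    by exists b'; split=> //; rewrite Hf; case: pselect.
  by apply: pi_forall; rewrite /inter; ar_tac; apply: (ar3 arR); ar_tac.
exists le; split.
- split.
    apply: (@pi_iff _ (fun e => W (e 1) /\ forall b, r (e 0) b 0 ->
      ~ sim (r (e 1)) (r (e 0)) 0 b)).
      move=> e; split=> -[We H]; split=> //.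
        move=> b b0 sb; have := proj1 (leE _ _ We) H; apply.
        by exists b.
      by apply/leE => // -[b [b0 sb]]; apply: (H b).
    apply: pi_and; first exact: (pi_ren (fun i => i.+1) HW).
    apply: pi_all; apply: pi_imp; first by apply: (ar3 arR); ar_tac.
    apply: (@pi_let (fun e n => ~ sim (r (e 2)) (r (e 1)) n (e 0)) (fun=> 0)); first by ar_tac.
    exact: (pi_ren (fun i => match i with 0 => 3 | 1 => 2 | 2 => 0 | _ => 1 end) pi_nsim).
  apply: pi_and; first exact: (pi_ren (fun i => i.+1) HW).
  apply: (@pi_let (fun e n => ~ sim (r (e 0)) (r (e 1)) n 0) (fun=> 0)); first by ar_tac.
  apply: (@pi_let (fun e n => ~ sim (r (e 1)) (r (e 2)) (e 0) n) (fun=> 0)); first by ar_tac.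
  exact: (pi_ren (fun i => match i with 0 => 2 | 1 => 3 | 2 => 1 | _ => 0 end) pi_nsim).
- by move=> m; apply: sim_refl.
- by move=> k m /HR Wm km; apply/HR; apply: sim_acc km.
have trans k m x : le k m -> le x k -> le x m by move=> km xk; apply: sim_trans xk km.
move=> k m /HR Wk _; have [km|[b [b0 mb]]] := sim_total (r m) Wk 0.
  by left=> x; apply: trans.
by right=> x; apply: trans; apply: sim_trans mb (sim_child Wk b0).
Qed.

(** * The measure of open sets *)

Lemma prefix_nthP (s t : seq bool) :
  reflect (forall i, i < size s -> i < size t /\ nth false s i = nth false t i) (prefix s t).
Proof.
apply: (iffP idP) => [/prefixP[r ->] i i_s|H].
  by rewrite size_cat nth_cat i_s ltn_addr.
have le : size s <= size t by rewrite leqNgt; apply/negP => lt; case: (H _ lt); rewrite ltnn.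
rewrite prefixE; apply/eqP; apply: (@eq_from_nth _ false); first by rewrite size_takel.
by move=> i; rewrite size_takel // => i_s; rewrite nth_take // (H i i_s).2.
Qed.

Lemma extendsP (X : cantor_space) s :
  extends X s <-> forall i, i < size s -> nth false s i = X i.
Proof.
split=> [-> i|H]; first by rewrite size_mkseq => i_s; rewrite nth_mkseq.
apply: (@eq_from_nth _ false); first by rewrite size_mkseq.
by move=> i i_s; rewrite nth_mkseq ?H.
Qed.

Lemma extends_mkseq (X : cantor_space) k : extends X (mkseq X k).
Proof. by rewrite /extends size_mkseq. Qed.

Lemma extends_prefix (X : cantor_space) s t :
  extends X s -> extends X t -> size s <= size t -> prefix s t.
Proof.
move=> /extendsP Xs /extendsP Xt st; apply/prefix_nthP => i i_s.
have i_t := leq_trans i_s st; by rewrite Xs ?Xt.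
Qed.

Lemma prefix_extends (X : cantor_space) s t : prefix s t -> extends X t -> extends X s.
Proof.
move=> /prefix_nthP st /extendsP Xt; apply/extendsP => i i_s.
by have [i_t ->] := st i i_s; rewrite Xt.
Qed.

Lemma prefix_comparable (s t u : seq bool) :
  prefix s u -> prefix t u -> size s <= size t -> prefix s t.
Proof.
move=> /prefix_nthP su /prefix_nthP tu st; apply/prefix_nthP => i i_s.
have i_t := leq_trans i_s st; split=> //.
by rewrite (su i i_s).2 (tu i i_t).2.
Qed.

Definition above (K : nat) (V : seq bool -> Prop) : {set K.-tuple bool} :=
  [set t : K.-tuple bool | `[< exists2 s : seq bool, V s & prefix s t >]].

(** Divided by [2 ^ K], this is the measure of the union of the cylinders of generators of length at
    most [K]; it increases with [K] to the measure of the open set. *)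
Definition cnt (K : nat) (V : seq bool -> Prop) : nat := #|above K V|.

Lemma aboveP K V (t : K.-tuple bool) : reflect (exists2 s : seq bool, V s & prefix s t) (t \in above K V).
Proof. by rewrite /above finset.in_set; exact: asboolP. Qed.

Lemma cnt_sub K (V W : seq bool -> Prop) : (forall s, V s -> W s) -> cnt K V <= cnt K W.
Proof.
move=> VW; apply/subset_leq_card/fintype.subsetP => t /aboveP[s /VW Ws st].
by apply/aboveP; exists s.
Qed.

Lemma cnt_mono K L V : K <= L -> cnt K V * 2 ^ (L - K) <= cnt L V.
Proof.
move=> /subnKC <-; move: (L - K) => d; rewrite addKn.
have -> : 2 ^ d = #|{: d.-tuple bool}| by rewrite card_tuple card_bool.
rewrite -cardsT -cardsX.
pose g (p : K.-tuple bool * d.-tuple bool) := [tuple of p.1 ++ p.2].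
rewrite -(card_imset (f := g)); last first.
  move=> [t u] [t' u'] /(congr1 val) /= /eqP.
  by rewrite eqseq_cat ?size_tuple // => /andP[/eqP/val_inj-> /eqP/val_inj->].
apply/subset_leq_card/fintype.subsetP => v /imsetP[[t u]].
rewrite finset.in_setX => /andP[/= /aboveP[s Vs st] _] ->; apply/aboveP; exists s => //=.
by apply: prefix_trans st _; exact: prefix_prefix.
Qed.

Lemma cnt1 K s : size s <= K -> cnt K (eq s) = 2 ^ (K - size s).
Proof.
move=> /subnKC <-; move: (K - size s) => d; rewrite addKn.
pose g (u : d.-tuple bool) := [tuple of in_tuple s ++ u].
rewrite -(card_bool) -(card_tuple d) -(cardsT) -(card_imset (f := g)); last first.
  by move=> u u' /(congr1 val) /= /eqP; rewrite eqseq_cat // eqxx => /eqP/val_inj.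
apply: eq_card => t; apply/aboveP/imsetP => [[_ <- /prefixP[r tr]]|[u _ ->]].
  have rd : size r == d by rewrite -(eqn_add2l (size s)) -size_cat -tr size_tuple.
  by exists (Tuple rd) => //; apply: val_inj.
by exists s => //=; exact: prefix_prefix.
Qed.

Lemma cnt_union K (F : seq (seq bool)) : {in F, forall s, size s <= K} ->
  cnt K (fun s => s \in F) <= \sum_(s <- F) 2 ^ (K - size s).
Proof.
elim: F => [|s F IH] FK.
  rewrite big_nil leqn0 cards_eq0; apply/eqP/setP => t; rewrite finset.in_set0.
  by apply/aboveP => -[].
rewrite big_cons -(@cnt1 K) ?FK ?mem_head //.
apply: leq_trans (leq_add (leqnn _) (IH _)); last by move=> t tF; rewrite FK // in_cons tF orbT.
apply: leq_trans (leq_card_setU _ _); apply/subset_leq_card/fintype.subsetP => t.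
rewrite finset.in_setU => /aboveP[s']; rewrite in_cons => /predU1P[->|s'F] st; apply/orP.
  by left; apply/aboveP; exists s.
by right; apply/aboveP; exists s'.
Qed.

Lemma count_le_has (T : eqType) (a : pred T) (F : seq T) : uniq F ->
  {in F &, forall s s', a s -> a s' -> s = s'} -> count a F <= has a F.
Proof.
elim: F => //= s F IH /andP[sF uF] H; have [as_|_] /= := boolP (a s); last first.
  by rewrite add0n; apply: IH => // t t' tF t'F; apply: H; rewrite in_cons ?tF ?t'F orbT.
suff -> : count a F = 0 by [].
apply/eqP; rewrite -leqn0 leqNgt -has_count; apply/hasP => -[t tF at_].
by move: sF; rewrite (H s t) ?tF ?mem_head // in_cons tF orbT.
Qed.

(** Double counting of the pairs [(s, t)] with [s] a prefix of [t]: two prefixes of the same [t] are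
    comparable, so an antichain contains at most one. *)
Lemma cnt_antichain K (F : seq (seq bool)) : uniq F -> {in F, forall s, size s <= K} ->
  {in F &, forall s s', prefix s s' -> s = s'} ->
  \sum_(s <- F) 2 ^ (K - size s) <= cnt K (fun s => s \in F).
Proof.
move=> uF FK anti.
have -> : \sum_(s <- F) 2 ^ (K - size s) =
    \sum_(s <- F) \sum_(t : K.-tuple bool) prefix s t.
  rewrite !big_seq; apply: eq_bigr => s sF; rewrite -cnt1 ?FK // /cnt -sum1_card.
  rewrite big_mkcond; apply: eq_bigr => t _.
  case: aboveP => [[_ <- ->]//|no]; case E: (prefix s t) => //.
  by case: no; exists s.
rewrite exchange_big /= /cnt -sum1_card [leqRHS]big_mkcond /=.
apply: leq_sum => t _.
rewrite -[X in X <= _](_ : count (fun s => prefix s t) F = _); last first.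
  by rewrite -sum1_count big_mkcond; apply: eq_bigr => s _; case: prefix.
apply: leq_trans (count_le_has uF _) _.
  move=> s s' sF s'F st s't; case: (leqP (size s) (size s')) => [|/ltnW] le.
    by apply: anti => //; exact: prefix_comparable st s't le.
  by apply/esym/anti => //; exact: prefix_comparable s't st le.
case: hasP => //= -[s sF st]; case: aboveP => // no.
by case: no; exists s.
Qed.

(** Compactness of Cantor space, used to extract finite covers. [big] selects the strings with
    arbitrarily long extensions in [T]. *)
Lemma konig (T : seq bool -> Prop) : (forall s t : seq bool, prefix s t -> T t -> T s) ->
  (forall L, exists2 u, size u = L & T u) -> exists X : cantor_space, forall k, T (mkseq X k).
Proof.
move=> clT unb.
pose big (s : seq bool) := forall L, exists u : seq bool, [/\ L <= size u, prefix s u & T u].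
have big0 : big [::].
  by move=> L; have [u uL Tu] := unb L; exists u; rewrite uL prefix0s.
have bigS s : big s -> exists b, big (rcons s b).
  move=> bs; apply: contrapT => /forallNP no.
  have /existsNP[L0 n0] := no false; have /existsNP[L1 n1] := no true.
  have [u [uL su Tu]] := bs (L0 + L1 + (size s).+1).
  have bu b : nth false u (size s) = b -> prefix (rcons s b) u.
    move=> E; apply/prefix_nthP => i; rewrite size_rcons ltnS => i_s.
    split; first by lia.
    move: i_s; rewrite leq_eqVlt nth_rcons => /predU1P[->|i_s]; first by rewrite ltnn eqxx.
    by rewrite i_s; have /prefix_nthP/(_ i i_s)[] := su.
  case E: (nth false u (size s)); [apply: n1|apply: n0]; exists u; split=> //.
  - by lia.
  - exact: bu.
  - by lia.
  - exact: bu.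
have step (s : {s | big s}) : exists b, big (rcons (sval s) b) by apply: bigS; exact: svalP.
have [g Hg] := choice step.
pose st n := iter n (fun s => exist big _ (Hg s)) (exist big _ big0).
pose X : cantor_space := fun n => g (st n).
exists X => k.
have E n : mkseq X n = sval (st n).
  by elim: n => [|n IH] //; rewrite /mkseq -[in LHS]addn1 iotaD map_cat -/(mkseq X n) IH add0n /= cats1.
have [u [_ su Tu]] := svalP (st k) 0.
by apply: clT Tu; rewrite E.
Qed.

Section Lambda.
Import Order.TTheory GRing.Theory Num.Theory.
Local Open Scope ring_scope.
Local Open Scope classical_set_scope.
Variable R : realType.
Implicit Types (V : set (seq bool)) (F : seq (seq bool)).

Let wt (s : seq bool) : R := 2 ^- size s.

Lemma sum_wt F K : {in F, forall s, (size s <= K)%N} ->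
  \sum_(s <- F) (wt s)%:E = ((\sum_(s <- F) 2 ^ (K - size s))%N%:R / 2 ^+ K)%:E.
Proof.
move=> FK; rewrite sumEFin; congr _%:E; rewrite natr_sum mulr_suml !big_seq.
apply: eq_bigr => s sF; rewrite natrX /wt -{2}(subnK (FK s sF)) exprD.
by rewrite invfM mulrA divff ?mul1r // expf_neq0 // pnatr_eq0.
Qed.

Lemma size_bound F : exists K, {in F, forall s, (size s <= K)%N}.
Proof.
elim: F => [|s F [K HK]]; first by exists 0%N.
exists (size s + K)%N => t; rewrite in_cons => /predU1P[->|/HK le]; first exact: leq_addr.
exact: leq_trans le (leq_addl _ _).
Qed.

(** From left to right, an arbitrary cover has to be compared with a finite level, which takes
    compactness. From right to left, one good cover is exhibited. *)
Lemma lambda_cnt V n : (lambda R (\bigcup_(s in V) cylinder s) <= (2 ^- n)%:E)%E <->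
  forall K, (cnt K V * 2 ^ n <= 2 ^ K)%N.
Proof.
have two_gt0 k : 0 < 2 ^+ k :> R by rewrite exprn_gt0.
have nat_le a K : (a%:R / 2 ^+ K <= 2 ^- n :> R) = (a * 2 ^ n <= 2 ^ K)%N.
  by rewrite ler_pdivrMr // mulrC ler_pdivlMr // -!natrX -natrM ler_nat.
split=> [le K|cV].
  rewrite -nat_le -lee_fin; apply: le_trans le.
  apply/ereal_infP => _ [W VW <-].
  pose c (t : seq bool) := size t = K /\ exists2 s : seq bool, V s & prefix s t.
  (* [T] is the tree of strings compatible with a string of [c] and not yet covered by [W]. A path
     through it would lie in the open set but escape the cover, so its height is bounded. *)
  pose T u := (forall s, W s -> ~~ prefix s u) /\
    exists2 t, c t & prefix u t || prefix t u.
  have clT (s t : seq bool) : prefix s t -> T t -> T s.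
    move=> st [nW [v cv tv]]; split.
      by move=> w Ww; apply/negP => ws; move/negP: (nW w Ww); apply; exact: prefix_trans st.
    exists v => //; case/orP: tv => [tv|vt]; first by rewrite (prefix_trans st tv).
    by case: (leqP (size s) (size v)) => [|/ltnW] le; apply/orP; [left|right];
       apply: prefix_comparable le; eauto.
  have [L HL] : exists L, forall u, (L <= size u)%N -> ~ T u.
    apply: contrapT => /forallNP no.
    have [X HX] : exists X : cantor_space, forall k, T (mkseq X k).
      apply: (konig clT) => L; have /existsNP[u /not_implyP[Lu /contrapT Tu]] := no L.
      exists (take L u); first by rewrite size_takel.
      by apply: clT Tu; apply: prefix_take.
    have [_ [t [tK [s Vs st]]] ] := HX K.
    have XK : extends X (mkseq X K) := extends_mkseq X K.
    move=> tX; have tE : mkseq X K = t.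
      by case/orP: tX => /prefixP[r E]; have := congr1 size E; rewrite size_cat size_mkseq tK;
         case: r E => [|? ?] //=; rewrite ?cats0 // => E; lia.
    have [|w Ww Xw] := VW X; first by exists s => //; apply: prefix_extends st _; rewrite -tE.
    by have [/(_ w Ww) + _] := HX (size w); rewrite -Xw prefix_refl.
  pose M := (K + L)%N.
  (* The members of [W] of length at most [M], a finite list that covers all of [c] at level [M]. *)
  pose F := [seq s <- undup [seq take k (val t) | t <- enum {: M.-tuple bool}, k <- iota 0 M.+1] |
             `[< W s >]].
  have FM : {in F, forall s, (size s <= M)%N}.
    move=> s; rewrite mem_filter mem_undup => /andP[_ /allpairsP[[t k] /= [_ _ ->]]].
    by rewrite size_take_min size_tuple geq_minr.
  apply: (@le_trans _ _ (\sum_(s <- F) (wt s)%:E)); last first.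
    apply: esum_ge; exists [set` F].
      split; first exact: finite_seq.
      by move=> s /=; rewrite mem_filter => /andP[/asboolP].
    by rewrite -fsbig_seq // filter_uniq // undup_uniq.
  rewrite (sum_wt FM) lee_fin ler_pdivrMr // mulrAC ler_pdivlMr // -!natrX -!natrM ler_nat.
  have cF : (cnt M c <= cnt M (fun s => s \in F))%N.
    apply/subset_leq_card/fintype.subsetP => t /aboveP[v cv vt].
    apply/aboveP; apply: contrapT => no; apply: (HL t); first by rewrite size_tuple leq_addl.
    split; last by exists v => //; rewrite vt orbT.
    move=> w Ww; apply/negP => wt_; apply: no; exists w => //.
    rewrite mem_filter; apply/andP; split; first exact/asboolP.
    rewrite mem_undup; apply/allpairsP; exists (t, size w); split.
    - by rewrite mem_enum.
    - by rewrite mem_iota add0n ltnS; have := size_prefix wt_; rewrite size_tuple.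
    - by move: wt_; rewrite prefixE => /eqP.
  have cK : (cnt K V <= cnt K c)%N.
    apply/subset_leq_card/fintype.subsetP => t /aboveP[v Vv vt].
    by apply/aboveP; exists (val t); [split; [exact: size_tuple|exists v]|exact: prefix_refl].
  have KM : (K <= M)%N by rewrite leq_addr.
  have := leq_trans (cnt_mono c KM) (leq_trans cF (cnt_union FM)).
  rewrite addKn => le; have -> : (2 ^ M = 2 ^ L * 2 ^ K)%N by rewrite -expnD addnC.
  rewrite mulnA leq_mul2r; apply/orP; right.
  by apply: leq_trans le; rewrite leq_mul2r cK orbT.
(* The prefix-minimal generators cover the same set and form an antichain, so their finite partial
   sums are bounded by counts. *)
apply: (@le_trans _ _ (\esum_(s in [set s | V s /\ forall s', V s' -> prefix s' s -> s' = s]) (wt s)%:E)%E).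
  apply: ereal_inf_lbound; exists [set s | V s /\ forall s', V s' -> prefix s' s -> s' = s] => //.
  move=> X [s Vs Xs].
  have ex : exists k, `[< V (mkseq X k) >] by exists (size s); apply/asboolP; rewrite -Xs.
  case: (ex_minnP ex) => k /asboolP Vk kmin; exists (mkseq X k); last exact: extends_mkseq.
  split=> // s' Vs' s'k; have Xs' := prefix_extends s'k (extends_mkseq X k).
  have le : (size s' <= k)%N by have := size_prefix s'k; rewrite size_mkseq.
  have ge : (k <= size s')%N by apply: kmin; apply/asboolP; rewrite -Xs'.
  by rewrite Xs'; congr mkseq; lia.
apply/ereal_supP => _ [A [Afin AV] <-].
have /finite_seqP[F0 AF] := Afin; pose F := undup F0.
have {}AF : A = [set` F] by rewrite AF; apply/seteqP; split=> s /=; rewrite mem_undup.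
have FV s : s \in F -> V s /\ forall s', V s' -> prefix s' s -> s' = s.
  by move=> sF; apply: AV; rewrite AF.
rewrite AF -fsbig_seq ?undup_uniq //.
have [K FK] := size_bound F.
rewrite (sum_wt FK) lee_fin nat_le; apply: leq_trans (cV K).
rewrite leq_mul2r; apply/orP; right.
apply: leq_trans (cnt_antichain _ FK _) _; first exact: undup_uniq.
  by move=> s s' sF s'F; apply: (FV s' s'F).2; exact: (FV s sF).1.
by apply: cnt_sub => s /FV[].
Qed.
End Lambda.

(** * Joins of strings *)

Definition evens (s : seq bool) : seq bool :=
  mkseq (fun i => nth false s i.*2) (uphalf (size s)).
Definition odds (s : seq bool) : seq bool :=
  mkseq (fun i => nth false s i.*2.+1) (size s)./2.

Lemma ltn_size_evens i s : (i < size (evens s)) = (i.*2 < size s).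
Proof. by rewrite size_mkseq gtn_uphalf_double. Qed.

Lemma ltn_size_odds i s : (i < size (odds s)) = (i.*2.+1 < size s).
Proof. by rewrite size_mkseq gtn_half_double. Qed.

Lemma nth_evens s i : i.*2 < size s -> nth false (evens s) i = nth false s i.*2.
Proof. by move=> lt; rewrite nth_mkseq // gtn_uphalf_double. Qed.

Lemma nth_odds s i : i.*2.+1 < size s -> nth false (odds s) i = nth false s i.*2.+1.
Proof. by move=> lt; rewrite nth_mkseq // gtn_half_double. Qed.

Lemma prefix_evens_odds (s t : seq bool) :
  prefix s t = prefix (evens s) (evens t) && prefix (odds s) (odds t).
Proof.
apply/idP/andP => [/prefix_nthP st|[/prefix_nthP ev /prefix_nthP od]].
  split; apply/prefix_nthP => i; rewrite !size_mkseq ?gtn_uphalf_double ?gtn_half_double => i_s;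
    have [i_t E] := st _ i_s; split=> //.
    by rewrite !nth_evens.
  by rewrite !nth_odds.
apply/prefix_nthP => i i_s; rewrite -(odd_double_half i) in i_s *.
case: (odd i) i_s; rewrite ?add0n ?add1n => i_s.
  have := od i./2; rewrite !size_mkseq !gtn_half_double => /(_ i_s) [i_t].
  by rewrite !nth_odds.
have := ev i./2; rewrite !size_mkseq !gtn_uphalf_double => /(_ i_s) [i_t].
by rewrite !nth_evens.
Qed.

Lemma extends_join (X Y : cantor_space) s :
  extends (oracle_join X Y) s <-> extends X (evens s) /\ extends Y (odds s).
Proof.
rewrite !extendsP; split=> [H|[HX HY] i i_s].
  split=> i; rewrite size_mkseq ?gtn_uphalf_double ?gtn_half_double => i_s.
    by rewrite nth_evens // H // /oracle_join odd_double doubleK.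
  by rewrite nth_odds // H // /oracle_join /= odd_double /= uphalf_double.
rewrite /oracle_join; have := odd_double_half i; case: (odd i) => [|]; rewrite ?add0n ?add1n => E.
  by rewrite -HY ?size_mkseq ?gtn_half_double ?E // nth_odds ?E.
by rewrite -HX ?size_mkseq ?gtn_uphalf_double ?E // nth_evens ?E.
Qed.

(** * Counting pairs of strings *)

Definition above2 K (G : seq bool -> seq bool -> Prop) : {set K.-tuple bool * K.-tuple bool} :=
  [set p : K.-tuple bool * K.-tuple bool | `[< exists r s, [/\ G r s, prefix r p.1 & prefix s p.2] >]].

Lemma above2P K G (p : K.-tuple bool * K.-tuple bool) :
  reflect (exists r s, [/\ G r s, prefix r p.1 & prefix s p.2]) (p \in above2 K G).
Proof. by rewrite /above2 inE; exact: asboolP. Qed.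

(** Interleaving is a bijection between pairs of strings of length [K] and strings of length
    [K + K]. *)
Lemma card_above2 K (G : seq bool -> seq bool -> Prop) :
  #|above2 K G| = cnt (K + K) (fun t => exists r s, [/\ G r s, prefix r (evens t) & prefix s (odds t)]).
Proof.
have sze (t : (K + K).-tuple bool) : size (evens t) == K by rewrite size_mkseq size_tuple; lia.
have szo (t : (K + K).-tuple bool) : size (odds t) == K by rewrite size_mkseq size_tuple; lia.
pose f (t : (K + K).-tuple bool) := (Tuple (sze t), Tuple (szo t)).
have f_inj : injective f.
  move=> t u [/= Ee Eo]; apply: val_inj => /=.
  have : prefix t u by rewrite prefix_evens_odds Ee Eo !prefix_refl.
  by rewrite prefixE !size_tuple -{1}(size_tuple u) take_size => /eqP.
have f_bij : bijective f.
  by apply: inj_card_bij f_inj _; rewrite card_prod !card_tuple expnD.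
rewrite -(on_card_preimset (onW_bij _ f_bij)) /cnt; apply: eq_card => t.
rewrite inE; apply/above2P/aboveP => [H|[u [r [s [Grs ru su]]]]].
  by exists (val t); [exact: H | exact: prefix_refl].
rewrite prefix_evens_odds => /andP[ut1 ut2]; exists r, s; split=> //.
  exact: prefix_trans ut1.
exact: prefix_trans ut2.
Qed.

Lemma card_pairs (S T : finType) (A : {set S * T}) :
  #|A| = \sum_(x : S) #|[set y | (x, y) \in A]|.
Proof.
rewrite -sum1_card [LHS](eq_bigl (fun p => (p.1, p.2) \in A)); last by case.
rewrite -(pair_big_dep xpredT (fun x y => (x, y) \in A) (fun _ _ => 1)) /=.
by apply: eq_bigr => x _; rewrite sum1_card; apply: eq_card => y; rewrite !inE.
Qed.

Lemma card_bigcup_leq (T : finType) (A : nat -> {set T}) K :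
  #|\bigcup_(q < K) A q| <= \sum_(q < K) #|A q|.
Proof.
elim: K => [|K IH]; first by rewrite !big_ord0 cards0.
rewrite !big_ord_recr /=; apply: leq_trans (leq_card_setU _ _) _.
exact: leq_add.
Qed.

Lemma sum_geom (a : nat -> nat) B K :
  (forall q, q < K -> a q * 2 ^ q.+1 <= B) -> \sum_(q < K) a q <= B.
Proof.
(* The induction needs the remainder of the geometric series: the partial sum is at most [B] minus
   [B / 2 ^ K]. *)
move=> H; suff : (\sum_(q < K) a q) * 2 ^ K + B <= B * 2 ^ K.
  have := expn_gt0 2 K; nia.
elim: K H => [|K IH] H; first by rewrite big_ord0; lia.
rewrite big_ord_recr /= expnS; have := H K (ltnSn K); rewrite expnS.
have : (\sum_(q < K) a q) * 2 ^ K + B <= B * 2 ^ K by apply: IH => q qK; apply: H; lia.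
move: (\sum_(q < K) a q) (2 ^ K) (a K) => s p c IH' cB.
have -> : (s + c) * (2 * p) = 2 * (s * p) + c * (2 * p) by lia.
have -> : B * (2 * p) = 2 * (B * p) by lia.
by lia.
Qed.

(** * Trimming an enumeration *)

(* [Q] is a set of indices of rectangles [tau q] x [sig q]; [S q] is the part of [Q] enumerated
   before [q] or at the same time. [approx q l] approximates from outside the closed set of oracles
   below [tau q] whose section of stage [q] has measure at most [2^-n]; from a [settled] level on,
   the measure of these approximations drops by at most [2^-(q+n+1)]. *)
Section Trim.
Variables (n : nat) (Q : nat -> Prop) (S : nat -> nat -> Prop) (tau sig : nat -> seq bool).
Hypothesis SQ : forall k q, Q q -> S k q -> Q k.
Hypothesis Srefl : forall q, S q q.
Hypothesis Schain : forall q q', Q q -> Q q' ->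
  (forall k, S k q -> S k q') \/ (forall k, S k q' -> S k q).
Hypothesis size_tau : forall q, size (tau q) <= q.

Definition stage_section q l (r s : seq bool) : Prop :=
  exists k, k < l /\ S k q /\ prefix (tau k) r /\ s = sig k.

Definition approx q l (r : seq bool) : Prop :=
  prefix (tau q) r /\ cnt l (stage_section q l r) * 2 ^ n <= 2 ^ l.

Definition card_approx q l : nat := #|[set r : l.-tuple bool | `[< approx q l r >]]|.

Definition settled q l : Prop := forall l', l <= l' ->
  card_approx q l * 2 ^ l' * 2 ^ (q + n).+1 <= card_approx q l' * 2 ^ l * 2 ^ (q + n).+1 + 2 ^ l * 2 ^ l'.

(** A string commits to [sig q] at its own length, provided this level is settled. By [q < size r],
    only indices below [K] matter at level [K]. *)
Definition trim (r s : seq bool) : Prop :=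
  exists q, Q q /\ s = sig q /\ q < size r /\ settled q (size r) /\ approx q (size r) r.

(** Every unsettled level is followed by a drop in measure of more than [1 / E]. The induction
    accumulates [j] drops, and [E.+1] of them would exceed the total measure 1. *)
Lemma settled_exists q : exists2 l, q < l & settled q l.
Proof.
apply: contrapT => no; set E := 2 ^ (q + n).+1.
suff [l ql] : exists2 l, q < l & card_approx q l * E + E.+1 * 2 ^ l <= 2 ^ l * E.
  have : 0 < 2 ^ l by rewrite expn_gt0.
  by nia.
elim: E.+1 => [|j [l ql IH]].
  exists q.+1 => //; rewrite mul0n addn0 leq_mul2r; apply/orP; right.
  by apply: leq_trans (max_card _) _; rewrite card_tuple card_bool.
have /existsNP[l' /not_implyP[ll' /negP]] : ~ settled q l by move=> gl; apply: no; exists l.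
rewrite -ltnNge -/E => lt; exists l'; first exact: leq_trans ll'.
have : 2 ^ l' = 2 ^ (l' - l) * 2 ^ l by rewrite -expnD subnK.
have : 0 < 2 ^ l by rewrite expn_gt0.
have : 0 < 2 ^ (l' - l) by rewrite expn_gt0.
move: lt IH; set a := card_approx q l; set b := card_approx q l'; set z := 2 ^ l; set d := 2 ^ (l' - l).
move=> lt IH d0 z0 E2; move: lt IH; rewrite {}E2.
have -> : a * (d * z) * E = z * (a * d * E) by lia.
have -> : b * z * E + z * (d * z) = z * (b * E + d * z) by lia.
rewrite ltn_mul2l z0 /= => lt IH.
have : d * (a * E + j * z) <= d * (z * E) by rewrite leq_mul2l IH orbT.
by nia.
Qed.

(** The approximations shrink, as a higher level sees more of the oracle and of the enumeration.
    Since [tau q] is no longer than [q], it survives the truncation to [l]. *)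
Lemma approx_mono q l K (x : K.-tuple bool) : q < l -> l <= K -> approx q K x -> approx q l (take l x).
Proof.
move=> ql lK [tx cx]; have xl : size (take l x) = l by rewrite size_takel ?size_tuple.
split.
  apply: prefix_comparable tx (prefix_take _ _) _.
  by rewrite xl; apply: leq_trans (size_tau q) (ltnW ql).
have le : cnt l (stage_section q l (take l x)) * 2 ^ (K - l) <= cnt K (stage_section q K x).
  apply: leq_trans (cnt_mono _ lK) _; apply: cnt_sub => s [k [kl [Sk [tk ->]]]].
  exists k; split; first exact: leq_trans lK.
  by do !split=> //; apply: prefix_trans tk (prefix_take _ _).
have : 2 ^ K = 2 ^ l * 2 ^ (K - l) by rewrite -expnD subnKC.
have : 0 < 2 ^ (K - l) by rewrite expn_gt0.
move: le cx; set a := cnt _ _; set b := cnt _ _; set d := 2 ^ (K - l) => le cx d0 E.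
rewrite -(leq_pmul2r d0) -E; apply: leq_trans cx.
by rewrite mulnAC leq_mul2r le orbT.
Qed.

Definition bad K q : {set K.-tuple bool} :=
  [set x : K.-tuple bool | `[< exists l, q < l /\ l <= K /\ settled q l /\ approx q l (take l x) /\ ~ approx q K x >]].

(** The least settled level accounts for all others: approximations decrease, so every bad string
    lies in the approximation of that level but not in that of level [K], and this difference is
    small by settledness. *)
Lemma card_bad K q : #|bad K q| * 2 ^ (q + n).+1 <= 2 ^ K.
Proof.
have [[l0 [ql0 [l0K gl0]]]|no] := pselect (exists l, q < l /\ l <= K /\ settled q l); last first.
  suff -> : bad K q = set0 by rewrite cards0.
  apply/setP => x; rewrite !inE; apply/asboolP => -[l [ql [lK [gl _]]]].
  by apply: no; exists l.
have ex : exists l, (q < l) && `[< settled q l >] by exists l0; rewrite ql0; apply/asboolP.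
case: (ex_minnP ex) => l /andP[ql /asboolP gl] lmin.
have lK : l <= K by apply: leq_trans l0K; apply: lmin; rewrite ql0; apply/asboolP.
pose A := [set x : K.-tuple bool | `[< approx q l (take l x) >]].
pose B := [set x : K.-tuple bool | `[< approx q K x >]].
have BA : B \subset A.
  by apply/subsetP => x; rewrite !inE => /asboolP Cx; apply/asboolP; exact: approx_mono.
have sub : bad K q \subset A :\: B.
  apply/subsetP => x; rewrite !inE => /asboolP[l1 [ql1 [l1K [gl1 [C1 nC]]]]].
  apply/andP; split; first by apply/asboolP.
  have ll1 : l <= l1 by apply: lmin; rewrite ql1; apply/asboolP.
  have sz1 : size (take l1 x) == l1 by rewrite size_takel ?size_tuple.
  have := @approx_mono q l l1 (Tuple sz1) ql ll1 C1 => /=; rewrite take_takel // => H.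
  exact/asboolP.
have cA : #|A| <= card_approx q l * 2 ^ (K - l).
  pose F := [seq val t | t <- enum [set r : l.-tuple bool | `[< approx q l r >]]].
  have szF : {in F, forall s, size s = l} by move=> s /mapP[t _ ->]; rewrite size_tuple.
  have := @cnt_union K F; rewrite big_seq (eq_bigr (fun=> 2 ^ (K - l))); last first.
    by move=> s /szF ->.
  rewrite -big_seq big_const_seq count_predT iter_addn_0 size_map -cardE mulnC => H.
  apply: leq_trans (H _); last by move=> s /szF ->.
  apply/subset_leq_card/subsetP => x; rewrite inE => /asboolP Cx.
  have sz : size (take l x) == l by rewrite size_takel ?size_tuple.
  apply/aboveP; exists (take l x); last exact: prefix_take.
  by apply/mapP; exists (Tuple sz) => //; rewrite mem_enum inE; apply/asboolP.
have : #|bad K q| + card_approx q K <= #|A|.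
  have := subset_leq_card sub; rewrite cardsD (setIidPr BA).
  have -> : card_approx q K = #|B| by [].
  by move=> le; rewrite -(subnK (subset_leq_card BA)) leq_add2r.
have := gl K lK; have : 2 ^ K = 2 ^ (K - l) * 2 ^ l by rewrite -expnD subnK.
have : 0 < 2 ^ l by rewrite expn_gt0.
move: cA; set a := card_approx q l; set b := card_approx q K; set E := 2 ^ (q + n).+1; set d := 2 ^ (K - l).
set z := 2 ^ l => cA z0 ->.
have -> : a * (d * z) * E = z * (a * d * E) by lia.
have -> : b * z * E + z * (d * z) = z * (b * E + d * z) by lia.
rewrite leq_pmul2l // => le le2.
have : (#|bad K q| + b) * E <= a * d * E by rewrite leq_mul2r (leq_trans le2 cA) orbT.
by lia.
Qed.

(** The factor 2 adds up two equal bounds: [P1] collects the pairs whose oracle still satisfies the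
    condition at level [K], and [P2] the errors, summed geometrically over the indices. *)
Lemma trim_bound K : #|above2 K trim| * 2 ^ n <= 2 * (2 ^ K * 2 ^ K).
Proof.
pose P1 : {set K.-tuple bool * K.-tuple bool} :=
  [set p : K.-tuple bool * K.-tuple bool | `[< exists q, [/\ q < K, Q q, approx q K p.1 & prefix (sig q) p.2] >]].
pose P2 := \bigcup_(q < K) setX (bad K q) [set: K.-tuple bool].
have sub : above2 K trim \subset P1 :|: P2.
  apply/subsetP => -[x y] /above2P[r [s /= [[q [Qq [-> [qr [gr Cr]]]]] rx sy]]].
  have rK : size r <= K by rewrite -(size_tuple x) size_prefix.
  have qK := leq_trans qr rK.
  rewrite inE; apply/orP; have [Cq|nCq] := pselect (approx q K x); [left|right].
    by rewrite inE; apply/asboolP; exists q.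
  apply/bigcupP; exists (Ordinal qK) => //; rewrite !inE /= andbT.
  have rE : take (size r) x = r by apply/eqP; rewrite -prefixE.
  by apply/asboolP; exists (size r); rewrite rE.
have c1 : #|P1| * 2 ^ n <= 2 ^ K * 2 ^ K.
  rewrite card_pairs big_distrl /=.
  have -> : 2 ^ K * 2 ^ K = \sum_(x : K.-tuple bool) 2 ^ K.
    by rewrite sum_nat_const card_tuple card_bool.
  apply: leq_sum => x _; pose L := [seq q <- iota 0 K | `[< Q q /\ approx q K x >]].
  have LP q : q \in L <-> [/\ q < K, Q q & approx q K x].
    rewrite mem_filter mem_iota add0n /=.
    by split=> [/andP[/asboolP[? ?] ?]|[? ? ?]] //; apply/andP; split=> //; apply/asboolP.
  have [L0|[q0 q0L q0max]] : L = [::] \/ exists2 q0, q0 \in L &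
      forall q, q \in L -> forall k, S k q -> S k q0.
    have LQ q : q \in L -> Q q by move=> /LP[].
    elim: L LQ {LP} => [|q L IH] LQ; [by left|right].
    have Qq : Q q by apply: LQ; rewrite mem_head.
    have [|->|[q0 q0L q0max]] := IH.
    - by move=> q' q'L; apply: LQ; rewrite in_cons q'L orbT.
    - by exists q; rewrite ?mem_head // => q'; rewrite inE => /eqP ->.
    have Qq0 : Q q0 by apply: LQ; rewrite in_cons q0L orbT.
    have [le|le] := Schain Qq Qq0.
      exists q0; first by rewrite in_cons q0L orbT.
      by move=> q'; rewrite in_cons => /predU1P[->|/q0max].
    exists q; first by rewrite mem_head.
    by move=> q'; rewrite in_cons => /predU1P[->|/q0max H] // k /H /le.
  - rewrite (_ : [set y | _] = set0) ?cards0 //; apply/setP => y; rewrite !inE.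
    apply/asboolP => -[q [/= qK Qq Cq _]].
    by have : q \in L by [apply/LP]; rewrite L0.
  have [q0K Qq0 [_ c0]] : [/\ q0 < K, Q q0 & approx q0 K x] by apply/LP.
  apply: leq_trans c0; rewrite leq_mul2r; apply/orP; right.
  apply/subset_leq_card/subsetP => y; rewrite !inE => /asboolP[q [/= qK Qq Cq sy]].
  apply/asboolP; exists (sig q) => //; have [tq _] := Cq.
  by exists q; do !split=> //; apply: (q0max q); [apply/LP|exact: Srefl].
have c2 : #|P2| * 2 ^ n <= 2 ^ K * 2 ^ K.
  have le : #|P2| <= \sum_(q < K) #|bad K q| * 2 ^ K.
    apply: (big_ind2 (fun (A : {set _}) m => #|A| <= m)).
    - by rewrite cards0.
    - move=> A a B b Aa Bb; apply: leq_trans (leq_card_setU A B) _; exact: leq_add.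
    - by move=> q _; rewrite cardsX cardsT card_tuple card_bool.
  rewrite -big_distrl /= in le.
  have : \sum_(q < K) #|bad K q| * 2 ^ n <= 2 ^ K.
    apply: (@sum_geom (fun q => #|bad K q| * 2 ^ n)) => q _.
    by rewrite -mulnA -expnD; have := card_bad K q; rewrite addnS addnC.
  rewrite -big_distrl /= => le2.
  apply: leq_trans (leq_mul le (leqnn (2 ^ n))) _.
  by rewrite mulnAC leq_mul2r le2 orbT.
have le := leq_trans (subset_leq_card sub) (leq_card_setU _ _).
apply: leq_trans (leq_mul le (leqnn (2 ^ n))) _.
by rewrite mulnDl mul2n -addnn leq_add.
Qed.

(** When the full section at [X] is small, so are all its stages, and [X] satisfies the condition at
    every level, in particular at a settled one. *)
Lemma trim_cover (X : cantor_space) q :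
  (forall K, cnt K (fun s => exists2 k, Q k & extends X (tau k) /\ s = sig k) * 2 ^ n <= 2 ^ K) ->
  Q q -> extends X (tau q) -> exists2 r, extends X r & trim r (sig q).
Proof.
move=> cX Qq Xq; have [l ql gl] := settled_exists q.
exists (mkseq X l); first exact: extends_mkseq.
exists q; rewrite size_mkseq; do !split=> //.
  apply: extends_prefix Xq (extends_mkseq X l) _.
  by rewrite size_mkseq; apply: leq_trans (size_tau q) (ltnW ql).
apply: leq_trans (cX l); rewrite leq_mul2r; apply/orP; right.
apply: cnt_sub => s [k [kl [Sk [tk ->]]]]; exists k; first exact: SQ Sk.
by split=> //; apply: prefix_extends tk (extends_mkseq X l).
Qed.
End Trim.

(** * Sections of large measure *)

Section Heavy.
Variable U : nat -> seq bool -> Prop.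
Hypothesis U_bound : forall n K, cnt K (U n) * 2 ^ n <= 2 ^ K.

Definition section n (r s : seq bool) : Prop :=
  exists2 t, U n.*2 t & prefix (evens t) r /\ s = odds t.

Definition heavy n (r : seq bool) : Prop := 2 ^ size r < cnt (size r) (section n r) * 2 ^ n.

Lemma heavy_prefix n r x : prefix r x -> heavy n r -> heavy n x.
Proof.
rewrite /heavy => rx; have le := size_prefix rx.
have lec : cnt (size r) (section n r) * 2 ^ (size x - size r) <= cnt (size x) (section n x).
  apply: leq_trans (cnt_mono _ le) _; apply: cnt_sub => s [t Ut [tr ->]].
  by exists t => //; split=> //; apply: prefix_trans tr rx.
have : 2 ^ size x = 2 ^ size r * 2 ^ (size x - size r) by rewrite -expnD subnKC.
have d0 : 0 < 2 ^ (size x - size r) by rewrite expn_gt0.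
move=> -> lt; apply: leq_trans (_ : _ <= cnt (size r) (section n r) * 2 ^ n * 2 ^ (size x - size r)) _.
  by rewrite ltn_mul2r d0.
by rewrite mulnAC leq_mul2r lec orbT.
Qed.

(** Markov's inequality by counting pairs at level [K]. The section comes from the component [n.*2]
    of the test, and half of that exponent is spent on the heaviness threshold. *)
Lemma card_heavy n K : #|[set x : K.-tuple bool | `[< heavy n x >]]| * 2 ^ n <= 2 ^ K.
Proof.
set B := [set x | _]; pose G r s := exists2 t, U n.*2 t & r = evens t /\ s = odds t.
have K0 : 0 < 2 ^ K by rewrite expn_gt0.
have le1 : #|B| * 2 ^ K <= #|above2 K G| * 2 ^ n.
  rewrite card_pairs big_distrl /= -sum_nat_const [leqLHS]big_mkcond /=.
  apply: leq_sum => x _; case: ifP => //; rewrite inE => /asboolP; rewrite /heavy size_tuple => lt.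
  apply: leq_trans (ltnW lt) _; rewrite leq_mul2r; apply/orP; right.
  apply/subset_leq_card/fintype.subsetP => y /aboveP[s [t Ut [tx ->]] ty].
  by rewrite finset.in_set; apply/above2P; exists (evens t), (odds t); split=> //; exists t.
have le2 : #|above2 K G| * 2 ^ n.*2 <= 2 ^ K * 2 ^ K.
  rewrite card_above2 -expnD; apply: leq_trans (U_bound n.*2 (K + K)); rewrite leq_mul2r; apply/orP; right.
  apply/subset_leq_card/fintype.subsetP => x /aboveP[u [r [s [[t Ut [-> ->]] tu su]]] ux].
  by apply/aboveP; exists t => //; apply: prefix_trans ux; rewrite prefix_evens_odds tu.
rewrite -(leq_pmul2r K0); apply: leq_trans le2.
by rewrite mulnAC -addnn expnD mulnA leq_mul2r le1 orbT.
Qed.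

Lemma heavy_bound m K : cnt K (fun r => exists2 n, m < n & heavy n r) * 2 ^ m <= 2 ^ K.
Proof.
pose A j := [set x : K.-tuple bool | `[< heavy (m + j).+1 x >]].
have sub : above K (fun r => exists2 n, m < n & heavy n r) \subset \bigcup_(j < K) A j.
  apply/fintype.subsetP => x /aboveP[r [n mn hn] rx]; have hx := heavy_prefix rx hn.
  have nE : (m + (n - m.+1)).+1 = n by lia.
  have xA : x \in A (n - m.+1) by rewrite /A nE finset.in_set; apply/asboolP.
  have lt : n - m.+1 < K.
    (* A nonempty set of strings of length [K] has measure at least [2 ^- K], so only finitely many
       [n] contribute at level [K]. *)
    have : n <= K; last by lia.
    rewrite -(@leq_exp2l 2) //; apply: leq_trans (card_heavy n K).
    rewrite leq_pmull //; apply/card_gt0P; exists x.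
    by rewrite finset.in_set; apply/asboolP.
  by apply/bigcupP; exists (Ordinal lt).
have := leq_trans (subset_leq_card sub) (card_bigcup_leq A K) => le.
apply: leq_trans (leq_mul le (leqnn (2 ^ m))) _; rewrite big_distrl /=.
apply: (@sum_geom (fun j => #|A j| * 2 ^ m)) => j _.
by rewrite -mulnA -expnD addnS; exact: card_heavy.
Qed.
End Heavy.

(** * Arithmetical relations on codes of strings *)

(** The index map [g] will be the identity, doubling, or doubling plus one. It reads the bits of [t]
    off the longer string [u], so the even and odd parts never need codes of their own. *)
Lemma prefix_codeP (s t : seq bool) (g : nat -> nat) (u : seq bool) :
  (forall i, (i < size t) = (g i < size u)) ->
  (forall i, g i < size u -> nth false t i = nth false u (g i)) ->
  prefix s t <-> forall i, i < size s -> g i < size u /\ nth false s i = nth false u (g i) :> nat.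
Proof.
move=> sz E; split=> [/prefix_nthP H i i_s|H].
  by have [i_t ->] := H i i_s; rewrite -E -?sz.
apply/prefix_nthP => i i_s; have [i_u Ei] := H i i_s; rewrite sz E //; split=> //.
by move: Ei; do 2 case: nth.
Qed.

Lemma prefix_codeP' (s t : seq bool) (g : nat -> nat) (u : seq bool) :
  (forall i, (i < size s) = (g i < size u)) ->
  (forall i, g i < size u -> nth false s i = nth false u (g i)) ->
  prefix s t <-> forall i, g i < size u -> i < size t /\ nth false u (g i) = nth false t i :> nat.
Proof.
move=> sz E; split=> [/prefix_nthP H i i_u|H].
  have i_s : i < size s by rewrite sz.
  by have [i_t <-] := H i i_s; rewrite E.
apply/prefix_nthP => i; rewrite sz => i_u; have [i_t Ei] := H i i_u; rewrite E //; split=> //.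
by move: Ei; do 2 case: nth.
Qed.

Lemma ar_prefix t u : arith_fn t -> arith_fn u -> arith (fun f e => prefix (str_of (t f e)) (str_of (u f e))).
Proof.
apply: (@ar2 (fun a b => prefix (str_of a) (str_of b))).
apply: (@ar_iff _ (fun _ e => forall i, i < csize (e 0) -> i < csize (e 1) /\
  cbit (e 0) i = cbit (e 1) i)); last by ar_tac.
by move=> f e; apply: (@prefix_codeP _ _ id).
Qed.

Lemma ar_prefix_evens t u :
  arith_fn t -> arith_fn u -> arith (fun f e => prefix (str_of (t f e)) (evens (str_of (u f e)))).
Proof.
apply: (@ar2 (fun a b => prefix (str_of a) (evens (str_of b)))).
apply: (@ar_iff _ (fun _ e => forall i, i < csize (e 0) -> 2 * i < csize (e 1) /\
  cbit (e 0) i = cbit (e 1) (2 * i))); last by ar_tac.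
move=> f e; apply: (@prefix_codeP _ _ (fun i => 2 * i)) => i; rewrite mul2n.
  exact: ltn_size_evens.
exact: nth_evens.
Qed.

Lemma ar_prefix_odds t u :
  arith_fn t -> arith_fn u -> arith (fun f e => prefix (str_of (t f e)) (odds (str_of (u f e)))).
Proof.
apply: (@ar2 (fun a b => prefix (str_of a) (odds (str_of b)))).
apply: (@ar_iff _ (fun _ e => forall i, i < csize (e 0) -> (2 * i).+1 < csize (e 1) /\
  cbit (e 0) i = cbit (e 1) (2 * i).+1)); last by ar_tac.
move=> f e; apply: (@prefix_codeP _ _ (fun i => (2 * i).+1)) => i; rewrite mul2n.
  exact: ltn_size_odds.
exact: nth_odds.
Qed.

Lemma ar_evens_prefix t u :
  arith_fn t -> arith_fn u -> arith (fun f e => prefix (evens (str_of (t f e))) (str_of (u f e))).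
Proof.
apply: (@ar2 (fun a b => prefix (evens (str_of a)) (str_of b))).
apply: (@ar_iff _ (fun _ e => forall i, 2 * i < csize (e 0) -> i < csize (e 1) /\
  cbit (e 0) (2 * i) = cbit (e 1) i)); last by ar_tac.
move=> f e; apply: (@prefix_codeP' _ _ (fun i => 2 * i)) => i; rewrite mul2n.
  exact: ltn_size_evens.
exact: nth_evens.
Qed.

Lemma ar_odds_prefix t u :
  arith_fn t -> arith_fn u -> arith (fun f e => prefix (odds (str_of (t f e))) (str_of (u f e))).
Proof.
apply: (@ar2 (fun a b => prefix (odds (str_of a)) (str_of b))).
apply: (@ar_iff _ (fun _ e => forall i, (2 * i).+1 < csize (e 0) -> i < csize (e 1) /\
  cbit (e 0) (2 * i).+1 = cbit (e 1) i)); last by ar_tac.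
move=> f e; apply: (@prefix_codeP' _ _ (fun i => (2 * i).+1)) => i; rewrite mul2n.
  exact: ltn_size_odds.
exact: nth_odds.
Qed.

Ltac ar_ext ::=
  match goal with
  | |- arith (fun f e => is_true (prefix (evens _) _)) => apply: ar_evens_prefix
  | |- arith (fun f e => is_true (prefix (odds _) _)) => apply: ar_odds_prefix
  | |- arith (fun f e => is_true (prefix _ (evens _))) => apply: ar_prefix_evens
  | |- arith (fun f e => is_true (prefix _ (odds _))) => apply: ar_prefix_odds
  | |- arith (fun f e => is_true (prefix _ _)) => apply: ar_prefix
  end.

(** * Tests *)

Lemma Pi11_pi11 (A : set nat) : Pi11 A <-> pi11 (fun e => A (e 0)).
Proof.
split=> [[p Hp]|[Q [p Hp] HQ]].
  exists (fun f e => sat f (fun i => if i is 0 then e 0 else 0) p).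
    exists (fsub (fun i => if i is 0 then Var 0 else Zero) p) => f e.
    by rewrite sat_sub; suff -> : (fun i => if i is 0 then e 0 else 0) =
      (fun i => teval f e (if i is 0 then Var 0 else Zero)) by []; apply: funext => -[].
  move=> e; rewrite Hp; have -> : (fun i => if i is 0 then e 0 else 0) = nth 0 [:: e 0].
    by apply: funext => -[|[]].
  by split=> H f; have := H f; rewrite holds_sat.
exists p => n; have := HQ (nth 0 [:: n]) => /= ->.
by split=> H f; have := H f; rewrite holds_sat Hp.
Qed.

Lemma cnt_atleast K V N (P : nat -> Prop) :
  (forall d, P d <-> csize d = K /\ exists2 s, V s & prefix s (str_of d)) ->
  N <= cnt K V <-> atleast N P.
Proof.
move=> HP; apply: (@atleastP _ _ (fun t : K.-tuple bool => str_code t)).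
  by move=> t u /str_code_inj /val_inj.
move=> c; rewrite HP; split=> [[cK [s Vs sc]]|[t /aboveP[s Vs st] ->]].
  have sz : size (str_of c) == K by apply/eqP.
  by exists (Tuple sz); [apply/aboveP; exists s|rewrite /= str_ofK].
by rewrite /csize str_codeK size_tuple; split=> //; exists s.
Qed.

Section Tests.
Variable R : realType.

(** Tests become Pi11 relations between numbers with a counting bound, which removes functionals,
    open sets and real numbers from the rest of the argument. *)
Lemma rel_randomP (X Z : cantor_space) :
  higher_ML_random_rel R X Z <->
  forall P : nat -> nat -> nat -> Prop, pi11 (fun e => P (e 0) (e 1) (e 2)) ->
    (forall n K, cnt K (fun s => exists2 t, extends X (str_of t) & P n t (str_code s)) * 2 ^ n
                 <= 2 ^ K) ->
    exists n, forall t s, P n t s -> extends X (str_of t) -> ~ extends Z (str_of s).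
Proof.
split=> [rnd P HP bound|H U [B [Psi HPsi BE] HU] allZ].
  pose Psi : set (seq bool * nat) :=
    [set tm | exists n s, tm.2 = pair_code n s /\ P n (str_code tm.1) s]%classic.
  pose B := enumerated Psi X.
  have BP n s : B (pair_code n (str_code s)) <->
      exists2 t, extends X (str_of t) & P n t (str_code s).
    split=> [[t Xt [n' [s' [/= /pair_code_inj[-> ->] Pt]]]]|[t Xt Pt]].
      by exists (str_code t); rewrite ?str_codeK.
    by exists (str_of t) => //; exists n, (str_code s); rewrite /= str_ofK.
  pose U n := (\bigcup_(s in [set s | B (pair_code n (str_code s))]) cylinder s)%classic.
  have /rnd/existsNP[n] : higher_ML_test R X U.
    exists B; first exists Psi => //.
      apply/Pi11_pi11; apply: (@pi_iff _ (fun e => exists t n s,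
          e 0 = pair_code t (pair_code n s) /\ P n t s)); last by pi_tac.
      move=> e; split=> [[[t m] [[n [s [/= -> Pt]]] ->]]|[t [n [s [-> Pt]]]]].
        by exists (str_code t), n, s.
      by exists (str_of t, pair_code n s); split; [exists n, s|]; rewrite /= str_ofK.
    move=> n; split=> //; apply/lambda_cnt => K; apply: leq_trans (bound n K).
    by rewrite leq_mul2r; apply/orP; right; apply: cnt_sub => s /BP.
  move=> /not_implyP[_ nU]; exists n => t s Pt Xt Zs; apply: nU.
  by exists (str_of s) => //=; apply/BP; rewrite str_ofK; exists t.
pose P n t s := Psi (str_of t, pair_code n s).
have PB n s : (exists2 t, extends X (str_of t) & P n t (str_code s)) <-> B (pair_code n (str_code s)).
  rewrite BE; split=> [[t Xt Pt]|[t Xt Pt]]; first by exists (str_of t).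
  by exists (str_code t); rewrite /P str_codeK.
have [||n Hn] := H P.
- have /Pi11_pi11 HA := HPsi.
  pose A k := exists tm, Psi tm /\ k = pair_code (str_code tm.1) tm.2.
  apply: (@pi_iff _ (fun e => A (pair_code (e 1) (pair_code (e 0) (e 2))))).
    move=> e; split=> [Pe|[[t m] [Pt /= /pair_code_inj[E1 E2]]]].
      by exists (str_of (e 1), pair_code (e 0) (e 2)); rewrite /= str_ofK.
    by rewrite /P E1 E2 str_codeK.
  by apply: (@pi1 A) => //; ar_tac.
- move=> n K; have [UE le] := HU n; move: le; rewrite UE => /lambda_cnt /(_ K).
  by apply: leq_trans; rewrite leq_mul2r; apply/orP; right; apply: cnt_sub => s /PB.
have := allZ n I; have [-> _] := HU n; move=> [s /PB[t Xt Pt] Zs].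
by apply: (Hn t _ Pt Xt); rewrite str_codeK.
Qed.

(** The strings extended by the empty oracle are those without a true bit, an arithmetical
    condition, so the oracle string can be quantified away. *)
Lemma randomP (Z : cantor_space) :
  higher_ML_random R Z <->
  forall P : nat -> nat -> Prop, pi11 (fun e => P (e 0) (e 1)) ->
    (forall n K, cnt K (fun s => P n (str_code s)) * 2 ^ n <= 2 ^ K) ->
    exists n, forall s, P n s -> ~ extends Z (str_of s).
Proof.
rewrite /higher_ML_random rel_randomP; split=> H P HP bound.
  have [||n Hn] := H (fun n _ s => P n s); first by pi_tac.
    move=> n K; apply: leq_trans (bound n K).
    by rewrite leq_mul2r; apply/orP; right; apply: cnt_sub => s [].
  exists n => s Ps; apply: (Hn (str_code [::])) => //; rewrite str_codeK; exact: (extends_mkseq _ 0).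
pose zero t := forall i, i < csize t -> cbit t i = 0.
have zeroP t : zero t <-> extends empty_oracle (str_of t).
  by rewrite extendsP; split=> E i it; have := E i it; rewrite /cbit; case: nth.
have [||n Hn] := H (fun n s => exists t, zero t /\ P n t s).
- by rewrite /zero; pi_tac; ar_tac.
- move=> n K; apply: leq_trans (bound n K).
  rewrite leq_mul2r; apply/orP; right; apply: cnt_sub => s [t [/zeroP ? ?]].
  by exists t.
by exists n => t s Pt /zeroP zt; apply: Hn; exists t.
Qed.

(** Tests for the join may be given by rectangles: a string lies inside a rectangle when its even
    and odd parts extend the two sides. *)
Lemma join_random_pair (X Y : cantor_space) : higher_ML_random R (oracle_join X Y) ->
  forall G : nat -> nat -> nat -> Prop, pi11 (fun e => G (e 0) (e 1) (e 2)) ->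
    (forall n K, #|above2 K (fun r s => G n (str_code r) (str_code s))| * 2 ^ n
                 <= 2 ^ K * 2 ^ K) ->
    exists n, forall r s, G n r s -> extends X (str_of r) -> ~ extends Y (str_of s).
Proof.
move=> /randomP rnd G HG bound.
have [||n Hn] := rnd (fun n t => exists r s, G n r s /\ prefix (str_of r) (evens (str_of t)) /\
    prefix (str_of s) (odds (str_of t))).
- by pi_tac.
- move=> n K; set V := fun s => _; have K0 : 0 < 2 ^ K by rewrite expn_gt0.
  (* Pairs of length [K] correspond to strings of length [K + K], so the count is first lifted from
     level [K] to level [K + K]. *)
  rewrite -(leq_pmul2r K0); apply: leq_trans (bound n K); rewrite mulnAC leq_mul2r; apply/orP; right.
  rewrite card_above2; have := @cnt_mono K (K + K) V; rewrite addKn => /(_ (leq_addr _ _)) le.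
  apply: leq_trans le _; apply: cnt_sub => t [r [s [Grs []]]]; rewrite str_codeK => rt st.
  by exists (str_of r), (str_of s); rewrite !str_ofK.
exists n => r s Grs Xr Ys; pose L := csize r + csize s.
pose t := mkseq (oracle_join X Y) (L + L).
have et := extends_mkseq (oracle_join X Y) (L + L); have /extends_join[Xt Yt] := et.
apply: (Hn (str_code t)); last by rewrite str_codeK.
exists r, s; rewrite str_codeK; split=> //; split.
  by apply: extends_prefix Xr Xt _; rewrite !size_mkseq /L /csize; lia.
by apply: extends_prefix Ys Yt _; rewrite !size_mkseq /L /csize; lia.
Qed.

Lemma join_random_left (X Y : cantor_space) :
  higher_ML_random R (oracle_join X Y) -> higher_ML_random R X.
Proof.
move=> rnd; apply/randomP => P HP bound.
(* Code 0 is the empty string, so the second side of each rectangle is the whole space. *)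
have [||n Hn] := join_random_pair rnd (G := fun n r s => P n r /\ s = 0).
- by pi_tac.
- move=> n K; set G := fun r s => _.
  have sub : above2 K G \subset finset.setX (above K (fun r => P n (str_code r))) [set: K.-tuple bool].
    apply/fintype.subsetP => -[x y] /above2P[r [s [[Pr _] rx _]]].
    by rewrite finset.in_setX finset.in_setT andbT; apply/aboveP; exists r.
  have := subset_leq_card sub; rewrite cardsX cardsT card_tuple card_bool => le.
  apply: leq_trans (leq_mul le (leqnn (2 ^ n))) _.
  by rewrite mulnAC leq_mul2r bound orbT.
exists n => s Ps Xs; apply: (Hn s 0) => //.
by rewrite -[0]/(str_code [::]) str_codeK; exact: (extends_mkseq _ 0).
Qed.

Lemma random_join (X Y : cantor_space) :
  higher_ML_random R X -> higher_ML_random_rel R X Y -> higher_ML_random R (oracle_join X Y).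
Proof.
move=> /randomP rX /rel_randomP rY; apply/randomP => P HP bound.
pose U n s := P n (str_code s).
have [||m Hm] := rX (fun m r => exists n, m < n /\ heavy U n (str_of r)).
(* Heaviness is witnessed by a number [y] of distinct strings in the section, which is positive in
   [P] and hence Pi11. *)
- apply: (@pi_iff _ (fun e => exists n, e 0 < n /\ exists y, atleast y (fun d =>
     csize d = csize (e 1) /\ exists t, P (n + n) t /\ prefix (evens (str_of t)) (str_of (e 1)) /\
     prefix (odds (str_of t)) (str_of d)) /\ 2 ^ csize (e 1) < y * 2 ^ n)).
    have secE n r y : y <= cnt (csize r) (section U n (str_of r)) <-> atleast y (fun d =>
      csize d = csize r /\ exists t, P (n + n) t /\ prefix (evens (str_of t)) (str_of r) /\
      prefix (odds (str_of t)) (str_of d)).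
      apply: cnt_atleast => d; split=> [[-> [t [Pt [tr td]]]]|[-> [s [t Ut [tr ->]] td]]].
        split=> //; exists (odds (str_of t)) => //; exists (str_of t) => //.
        by rewrite /U str_ofK -addnn.
      split=> //; exists (str_code t); rewrite addnn str_codeK; by [].
    move=> e; split=> -[n [en H]]; exists n; split=> //.
      by exists (cnt (csize (e 1)) (section U n (str_of (e 1)))); split=> //; apply/secE.
    by have [y [/secE le lt]] := H; apply: leq_trans lt _; rewrite leq_mul2r le orbT.
  by rewrite /atleast; pi_tac.
- move=> m K; apply: leq_trans (heavy_bound bound m K).
  rewrite leq_mul2r; apply/orP; right; apply: cnt_sub => s [n [mn hn]].
  by exists n => //; rewrite str_codeK in hn.
have light n r : m < n -> extends X r -> cnt (size r) (section U n r) * 2 ^ n <= 2 ^ size r.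
  move=> mn Xr; rewrite leqNgt; apply/negP => hv; apply: (Hm (str_code r)); rewrite str_codeK //.
  by exists n.
(* The index exceeds [m], so the section at [X] is not heavy. Requiring equal lengths makes the
   count at level [K] depend only on the first [K] bits of [X]. *)
have [||n Hn] := rY (fun n r s => csize r = csize s /\ exists t, P ((n + m).+1 + (n + m).+1) t /\
   prefix (evens (str_of t)) (str_of r) /\ prefix (odds (str_of t)) (str_of s)).
- by pi_tac.
- move=> n K.
  have := @light (n + m).+1 (mkseq X K) _ (extends_mkseq X K); rewrite size_mkseq => le.
  apply: leq_trans (le _); last by lia.
  apply: leq_mul; last by rewrite leq_exp2l //; lia.
  apply/subset_leq_card/fintype.subsetP => x /aboveP[s [r Xr [rs [t [Pt [tr]]]]]].
  rewrite str_codeK => ts sx; apply/aboveP; exists (odds (str_of t)); last exact: prefix_trans sx.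
  exists (str_of t); first by rewrite /U str_ofK -addnn.
  split=> //; apply: prefix_trans tr _; apply: extends_prefix Xr (extends_mkseq X K) _.
  rewrite size_mkseq -/(csize r) rs /csize str_codeK -(size_tuple x); exact: size_prefix.
exists ((n + m).+1 + (n + m).+1) => t Pt et; pose L := csize t.
have /extends_join[Xt Yt] := et.
apply: (Hn (str_code (mkseq X L)) (str_code (mkseq Y L))); rewrite ?str_codeK; try exact: extends_mkseq.
rewrite /csize !str_codeK !size_mkseq; split=> //; exists t; split=> //; split.
  by apply: extends_prefix Xt (extends_mkseq X L) _; rewrite !size_mkseq /L /csize; lia.
by apply: extends_prefix Yt (extends_mkseq Y L) _; rewrite !size_mkseq /L /csize; lia.
Qed.

End Tests.

(** * Definability of the trimmed test and the main argument *)

(** An upper bound on a count uses [S] negatively, and [settled] compares counts in both directions,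
    so Delta11 is propagated through every layer. It is available on [Q] only, which [trim] demands
    of its index. *)
Lemma pi_trim (Q : nat -> nat -> Prop) (S : nat -> nat -> nat -> Prop) (tau sig : nat -> nat) :
  arith_fn (fun _ e => tau (e 0)) -> arith_fn (fun _ e => sig (e 0)) ->
  pi11 (fun e => Q (e 0) (e 1)) -> delta11 (fun e => Q (e 0) (e 1)) (fun e => S (e 0) (e 1) (e 2)) ->
  pi11 (fun e => trim (e 0) (Q (e 0)) (fun k q => S (e 0) q k)
    (fun q => str_of (tau q)) (fun q => str_of (sig q)) (str_of (e 1)) (str_of (e 2))).
Proof.
move=> fn_tau fn_sig HQ HS; pose T q := str_of (tau q); pose s q := str_of (sig q).
pose Cc n q l r := approx n (fun k q => S n q k) T s q l (str_of r).
pose Nc n q l x : Prop := x <= card_approx n (fun k q => S n q k) T s q l.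
pose gc n q l := settled n (fun k q => S n q k) T s q l.
have HC : delta11 (fun e => Q (e 0) (e 1)) (fun e => Cc (e 0) (e 1) (e 2) (e 3)).
  apply: (@dl_iff _ _ (fun e => prefix (str_of (tau (e 1))) (str_of (e 3)) /\
    forall y, atleast y (fun d => csize d = e 2 /\ exists k, k < e 2 /\ S (e 0) (e 1) k /\
      prefix (str_of (tau k)) (str_of (e 3)) /\ prefix (str_of (sig k)) (str_of d)) ->
      y * 2 ^ e 0 <= 2 ^ e 2)).
    move=> e; rewrite /Cc /approx -/(T _).
    set c := cnt _ _; set P := fun d => _.
    have cP y : y <= c <-> atleast y P.
      apply: cnt_atleast => d; split=> [[dK [k [kl [Sk [tk sk]]]]]|[dc [u [k [kl [Sk [tk ->]]]] sk]]].
        by split=> //; exists (s k) => //; exists k.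
      by split=> //; exists k.
    split=> -[Tq H]; split=> //.
      by move=> y /cP yc; apply: leq_trans H; rewrite leq_mul2r yc orbT.
    by apply: H; apply/cP.
  rewrite /atleast; repeat dl_step => //; apply: fn1 => //; ar_tac.
have HN : delta11 (fun e => Q (e 0) (e 1)) (fun e => Nc (e 0) (e 1) (e 2) (e 3)).
  apply: (@dl_iff _ _ (fun e => atleast (e 3) (fun d => csize d = e 2 /\ Cc (e 0) (e 1) (e 2) d))).
    move=> e; apply: (@atleastP _ _ (fun t : (e 2).-tuple bool => str_code t)).
      by move=> t u /str_code_inj /val_inj.
    move=> c; split=> [[cl Cq]|[t]].
      have sz : size (str_of c) == e 2 by apply/eqP.
      by exists (Tuple sz); [rewrite inE; apply/asboolP|rewrite /= str_ofK].
    rewrite inE => /asboolP Cq ->; rewrite /csize /Cc str_codeK size_tuple; by [].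
  by rewrite /atleast; repeat dl_step.
have Hg : delta11 (fun e => Q (e 0) (e 1)) (fun e => gc (e 0) (e 1) (e 2)).
  (* An inequality between two cardinalities, phrased through lower bounds: each lower bound of the
     first is matched by one of the second. *)
  apply: (@dl_iff _ _ (fun e => forall l, e 2 <= l -> forall x, Nc (e 0) (e 1) (e 2) x ->
    exists y, Nc (e 0) (e 1) l y /\
    x * 2 ^ l * 2 ^ (e 1 + e 0).+1 <= y * 2 ^ e 2 * 2 ^ (e 1 + e 0).+1 + 2 ^ e 2 * 2 ^ l)).
    move=> e; rewrite /gc /settled /Nc; split=> [H l le x xN|H l le].
      exists (card_approx (e 0) (fun k q => S (e 0) q k) T s (e 1) l); split=> //.
      by apply: leq_trans (H l le); rewrite !leq_mul2r xN !orbT.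
    have [y [yN le2]] := H l le _ (leqnn _); apply: leq_trans le2 _.
    by rewrite leq_add2r !leq_mul2r yN !orbT.
  by repeat dl_step.
apply: (@pi_iff _ (fun e => exists q, (Q (e 0) q /\ e 2 = sig q) /\ q < csize (e 1) /\
  (Q (e 0) q /\ gc (e 0) q (csize (e 1))) /\ (Q (e 0) q /\ Cc (e 0) q (csize (e 1)) (e 1)))).
  move=> e; split=> [[q [Qq [sq [qr [gr Cr]]]]]|[q [[Qq sq] [qr [[_ gr] [_ Cr]]]]]]; exists q.
    by do !split=> //; rewrite -[LHS]str_ofK sq str_ofK.
  by rewrite sq.
apply: pi_ex; apply: pi_and; first by pi_tac; apply: fn1 => //; ar_tac.
apply: pi_and; first by pi_tac.
by apply: pi_and; apply: dl_pi; [apply: (dl3 Hg)|apply: (dl4 HC)]; ar_tac.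
Qed.

Section Main.
Variable R : realType.

Lemma join_random_right (X Y : cantor_space) :
  higher_ML_random R (oracle_join X Y) -> higher_ML_random_rel R X Y.
Proof.
move=> rnd; apply/rel_randomP => P HP bound.
(* The test index is part of the code, so a single norm serves all components and the trimming is
   uniform in [n]. *)
pose W m := P (p1 m) (p1 (p2 m)) (p2 (p2 m)).
have HW : pi11 (fun e => W (e 0)) by rewrite /W; pi_tac.
have [le [dle le_refl leW le_chain]] := pi_norm HW.
pose Q n q := W (pair_code n q); pose S n q k := le (pair_code n k) (pair_code n q).
have HQ : pi11 (fun e => Q (e 0) (e 1)) by rewrite /Q; pi_tac.
have HS : delta11 (fun e => Q (e 0) (e 1)) (fun e => S (e 0) (e 1) (e 2)).
  have [H1 H2] := dle; split.
    by apply: (@pi2 (fun k m => W m /\ le k m)) => //; ar_tac.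
  by apply: (@pi2 (fun k m => W m /\ ~ le k m)) => //; ar_tac.
pose T q := str_of (p1 q); pose s q := str_of (p2 q).
have fn_p1' : arith_fn (fun _ e => p1 (e 0)) by ar_tac.
have fn_p2' : arith_fn (fun _ e => p2 (e 0)) by ar_tac.
have size_T q : size (T q) <= q.
  by apply: leq_trans (leq_csize _) _; have := leq_pair_code (p1 q) (p2 q); rewrite pair_codeK => -[].
have SQ n k q : Q n q -> S n q k -> Q n k by move=> Qq; apply: leW.
have Schain n q q' : Q n q -> Q n q' ->
    (forall k, S n q k -> S n q' k) \/ (forall k, S n q' k -> S n q k).
  by move=> Qq Qq'; have [H|H] := le_chain _ _ Qq Qq'; [left|right] => k; apply: H.
(* The shift to [n.+1] absorbs the factor 2 of [trim_bound]. *)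
have [||n Hn] := join_random_pair rnd (G := fun n r u =>
    trim n.+1 (Q n.+1) (fun k q => S n.+1 q k) T s (str_of r) (str_of u)).
- have := pi_trim fn_p1' fn_p2' HQ HS.
  move=> /(@pi3 (fun n r u => trim n (Q n) (fun k q => S n q k) T s (str_of r) (str_of u))).
  by apply; ar_tac.
- move=> n K.
  have := @trim_bound n.+1 (Q n.+1) (fun k q => S n.+1 q k) T s
    (fun q => le_refl _) (Schain n.+1) size_T K.
  rewrite expnS mulnCA leq_pmul2l // => H; apply: leq_trans H; rewrite leq_mul2r; apply/orP; right.
  apply/subset_leq_card/fintype.subsetP => x /above2P[r [u [Gru rx ux]]].
  by apply/above2P; exists r, u; rewrite !str_codeK in Gru.
exists n.+1 => t u Pt Xt Yu; pose q := pair_code t u.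
have Qq : Q n.+1 q by rewrite /Q /W p1K p2K /q p1K p2K.
have [||r Xr Gr] := @trim_cover n.+1 (Q n.+1) (fun k q => S n.+1 q k) T s
    (SQ n.+1) size_T X q _ Qq.
- move=> K; apply: leq_trans (bound n.+1 K); rewrite leq_mul2r; apply/orP; right.
  apply: cnt_sub => v [k Qk [Xk ->]]; exists (p1 k) => //.
  by move: Qk; rewrite /Q /W p1K p2K /s str_ofK.
- by rewrite /T p1K.
by apply: (Hn (str_code r) u); rewrite ?str_codeK //; rewrite /s /q p2K in Gr.
Qed.
End Main.

Theorem theorem1p4 (R : realType) (X Y : cantor_space) :
  higher_ML_random R (oracle_join X Y) <->
  (higher_ML_random R X /\ higher_ML_random_rel R X Y).
Proof.
split=> [rnd|[rX rY]]; last exact: random_join.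
by split; [exact: join_random_left rnd|exact: join_random_right].
Qed.
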